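(* Suppose that there is $0<\alpha<1$ such that for $m$-almost every $\underline{x}\in\Sigma_A^+$ one has $d(G(\underline{x},y_1),G(\underline{x},y_2))\le \alpha\, d(y_1,y_2)$ for all $y_1,y_2\in K$. Then there are $0<\alpha_1<1$ and $B_4\in\mathbb{R}$ such that for all $\mu\in S^\infty$ and all $n\ge1$, $$\|F^{*n}\mu\|_{S^\infty}\le 2\alpha_1^n\|\mu\|_{S^\infty}+B_4\|\mu\|_\infty.$$
   Context: Base. Let $A$ be an aperiodic $N\times N$ matrix with entries in $\{0,1\}$ (some power of $A$ has all entries positive), $\Sigma_A^+=\{\underline{x}=(x_i)_{i\ge 0}: x_i\in\{1,\dots,N\},\ A_{x_ix_{i+1}}=1\ \forall i\}$, with the metric $d_\theta(\underline{x},\underline{y})=\sum_{i\ge0}\theta^i(1-\delta(x_i,y_i))$, where $\theta\in(0,1)$ is fixed and $\delta(a,b)=1$ if $a=b$, $0$ otherwise. Let $\sigma$ be the left shift and $m$ a Markov measure associated to $(\Sigma_A^+,\sigma)$ (the $\sigma$-invariant probability given by a stochastic matrix $(p_{ij})$ with $p_{ij}>0$ iff $A_{ij}=1$ and its stationary probability vector). For $\varphi:\Sigma_A^+\to\mathbb{R}$ let $|\varphi|_\theta$ be its Lipschitz constant with respect to $d_\theta$, $\mathcal{F}_\theta(\Sigma_A^+)=\{\varphi:|\varphi|_\theta<\infty\}$, $\|\varphi\|_\theta=\|\varphi\|_\infty+|\varphi|_\theta$. Skew product. $(K,d)$ is a compact metric space with $\operatorname{diam}(K)=1$; $\Sigma:=\Sigma_A^+\times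 K$; $G:\Sigma\to K$ is measurable (Borel) and $F(\underline{x},y)=(\sigma(\underline{x}),G(\underline{x},y))$. Put $\gamma_{\underline{x}}=\{\underline{x}\}\times K$, $\pi_1(\underline{x},y)=\underline{x}$, $\pi_2(\underline{x},y)=y$; $\pi_1^*$ denotes push-forward, $F^*\mu(E)=\mu(F^{-1}(E))$ for signed measures $\mu$ on $\Sigma$, and $F^{*n}$ is its $n$-th iterate. Spaces of measures. For a finite signed Borel measure $\nu$ on a compact metric space $X$, $\|\nu\|_W=\sup\{|\int g\,d\nu| : g:X\to\mathbb{R}\text{ Lipschitz with constant}\le1,\ \|g\|_\infty\le1\}$. Let $\mathcal{AB}$ be the set of finite signed Borel measures $\mu$ on $\Sigma$, with Jordan decomposition $\mu=\mu^+-\mu^-$, such that $\pi_1^*\mu^+\ll m$ and $\pi_1^*\mu^-\ll m$; write $\phi_1=\frac{d(\pi_1^*\mu)}{dm}$. For positive $\mu\in\mathcal{AB}$ let $\{\mu_{\gamma_{\underline{x}}}\}$ be its Rokhlin disintegration along the leaves: probabilities on $\Sigma$ with $\mu_{\gamma_{\underline{x}}}(\gamma_{\underline{x}})=1$ for $\phi_1m$-a.e. $\underline{x}$, $\underline{x}\mapsto\mu_{\gamma_{\underline{x}}}(E)$ measurable, and $\mu(E)=\int\mu_{\gamma_{\underline{x}}}(E)\phi_1(\underline{x})\,dm(\underline{x})$ for all measurable $E\subset\Sigma$. The restriction of positive $\mu$ to $\gamma_{\underline{x}}$ is the positive measure on $K$ given by $\mu|_{\gamma_{\underline{x}}}(B)=\phi_1(\underline{x})\,\mu_{\gamma_{\underline{x}}}(\pi_2^{-1}(B))$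 (zero where $\phi_1(\underline{x})=0$); for signed $\mu\in\mathcal{AB}$, $\mu|_{\gamma_{\underline{x}}}:=\mu^+|_{\gamma_{\underline{x}}}-\mu^-|_{\gamma_{\underline{x}}}$. Set $\|\mu\|_\infty=\operatorname{ess\,sup}_{\underline{x}}\|\mu|_{\gamma_{\underline{x}}}\|_W$ (with respect to $m$), $\mathcal{L}^\infty=\{\mu\in\mathcal{AB}:\|\mu\|_\infty<\infty\}$, $S^\infty=\{\mu\in\mathcal{L}^\infty:\phi_1\in\mathcal{F}_\theta(\Sigma_A^+)\}$ and $\|\mu\|_{S^\infty}=\|\phi_1\|_\theta+\|\mu\|_\infty$. *)

(* Defs.v *)
From HB Require Import structures.
From mathcomp Require Import all_boot all_order all_algebra.
From mathcomp Require Import interval_inference.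
From mathcomp Require Import all_classical all_reals all_analysis.
From mathcomp Require Import measurable_realfun ess_sup_inf.

Set Implicit Arguments.
Unset Strict Implicit.
Unset Printing Implicit Defensive.

Import Order.TTheory GRing.Theory Num.Theory.
Import numFieldNormedType.Exports.

Local Open Scope classical_set_scope.
Local Open Scope ring_scope.
Local Open Scope charge_scope.

(* A measurableType has to be pointed, and the library has no join of Pointed
   and Metric. *)
#[short(type="pmetricType")]
HB.structure Definition PMetric (R : numDomainType) :=
  {M of Pointed M & Metric R M}.

Notation Borel X := (g_sigma_algebraType (@open X)).

(* The alphabet has N.+1 letters, so that it is nonempty.  The matrix power is
   taken in the semiring of square matrices over nat. *)
Record aperiodic_matrix (N : nat) := AperiodicMatrix {
  transition :> 'M[nat]_N.+1;
  transition01 : forall i j, (transition i j == 0%N) || (transition i j == 1%N);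
  transition_aperiodic :
    exists k, (0 < k)%N /\ forall i j, (0 < (transition ^+ k) i j)%N }.

(* theta is a phantom parameter of the type: it selects the metric dtheta, hence
   the topology and the Borel sets. *)
Definition subshift (R : realType) (N : nat) (A : aperiodic_matrix N)
    (theta : {itv R & `]0%Z, 1%Z[}) : Type :=
  {x : nat -> 'I_N.+1 | forall i, A (x i) (x i.+1) = 1%N}.

Section subshift.
Context {R : realType} {N : nat} {A : aperiodic_matrix N}.
Context {theta : {itv R & `]0%Z, 1%Z[}}.

Definition letter (x : subshift A theta) (i : nat) : 'I_N.+1 := sval x i.

Definition dtheta (x y : subshift A theta) : R :=
  limn (series (fun i => theta%:num ^+ i * (letter x i != letter y i)%:R)).

End subshift.

Section subshift_instances.
Context {R : realType} {N : nat}.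
Variables (A : aperiodic_matrix N) (theta : {itv R & `]0%Z, 1%Z[}).
Local Notation X := (subshift A theta).
Local Notation t := (theta%:num).
Local Notation u x y :=
  (fun i : nat => t ^+ i * (letter (x : X) i != letter (y : X) i)%:R : R).

HB.instance Definition _ := gen_eqMixin X.
HB.instance Definition _ := gen_choiceMixin X.

Lemma subshift_inj (x y : X) : letter x =1 letter y -> x = y.
Proof.
case: x y => [x Px] [y Py] /funext /= xy; apply: eq_exist; exact: xy.
Qed.

Lemma transition_next (i : 'I_N.+1) : exists j, A i j = 1%N.
Proof.
apply: contrapT => /forallNP noj.
have A0 j : A i j = 0%N.
  by case/orP: (transition01 A i j) => /eqP // /noj.
have [[|k] [k0 /(_ i i)]] := transition_aperiodic A => //.
rewrite exprS [X in (0 < X)%N]mxE big1// => j _.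
by rewrite A0 mul0r.
Qed.

Definition next_letter (i : 'I_N.+1) := sval (cid (transition_next i)).

Lemma subshift_point_subproof i :
  A (iter i next_letter ord0) (iter i.+1 next_letter ord0) = 1%N.
Proof. exact: (svalP (cid (transition_next _))). Qed.

Definition subshift_point : X := exist _ _ subshift_point_subproof.

HB.instance Definition _ := isPointed.Build X subshift_point.

Let t0 : 0 < t. Proof. by []. Qed.
Let t1 : t < 1. Proof. by []. Qed.

Let u_ge0 x y i : 0 <= u x y i.
Proof. by rewrite mulr_ge0// exprn_ge0// ltW. Qed.

Lemma is_cvg_dtheta (x y : X) : cvgn (series (u x y)).
Proof.
apply: (series_le_cvg (v_ := geometric 1 t)) => [i|i|i|].
- exact: u_ge0.
- by rewrite /geometric/= mul1r exprn_ge0// ltW.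
- by rewrite /geometric/= mul1r ler_piMr ?exprn_ge0 ?lern1 ?leq_b1// ltW.
- by apply: is_cvg_geometric_series; rewrite gtr0_norm.
Qed.

Lemma dthetaxx (x : X) : dtheta x x = 0.
Proof.
rewrite /dtheta; have -> : series (u x x) = cst 0.
  by apply/funext => n; rewrite /series/= big1// => i _; rewrite eqxx mulr0.
exact: lim_cst.
Qed.

Lemma dtheta_sym (x y : X) : dtheta x y = dtheta y x.
Proof.
by rewrite /dtheta; under eq_fun do rewrite eq_sym.
Qed.

Lemma dtheta_ge (x y : X) i : letter x i != letter y i -> t ^+ i <= dtheta x y.
Proof.
move=> xy; have nd : nondecreasing_seq (series (u x y)).
  by apply/nondecreasing_series => n _ _; exact: u_ge0.
have := nondecreasing_cvgn_le nd (@is_cvg_dtheta x y) i.+1.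
apply: le_trans.
rewrite /series/= big_nat_recr//= xy mulr1 lerDr.
by apply: sumr_ge0 => j _; exact: u_ge0.
Qed.

Lemma dtheta_positivity (x y : X) : dtheta x y = 0 -> x = y.
Proof.
move=> d0; apply: subshift_inj => i; apply/eqP/negPn/negP => /dtheta_ge.
by rewrite d0 leNgt exprn_gt0.
Qed.

Lemma dtheta_triangle (y x z : X) : dtheta x z <= dtheta x y + dtheta y z.
Proof.
rewrite /dtheta -limD; [|exact: is_cvg_dtheta..].
apply: ler_lim; [exact: is_cvg_dtheta| |].
  by apply: is_cvgD; exact: is_cvg_dtheta.
apply: nearW => n.
rewrite -[leRHS]/(series (u x y) n + series (u y z) n) /series/= -big_split/= ler_sum// => i _.
rewrite -mulrDr ler_wpM2l ?exprn_ge0 ?(ltW t0)// -natrD ler_nat.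
have [->|_] := eqVneq (letter x i) (letter y i); first by rewrite add0n.
exact: leq_trans (leq_b1 _) (leq_addr _ _).
Qed.

HB.instance Definition _ := @isMetric.Build R X (@dtheta R N A theta)
  dthetaxx dtheta_positivity dtheta_sym dtheta_triangle.

End subshift_instances.

Section shift.
Context {R : realType} {N : nat} {A : aperiodic_matrix N}.
Context {theta : {itv R & `]0%Z, 1%Z[}}.
Local Notation X := (subshift A theta).
Local Notation t := (theta%:num).

Definition shift (x : X) : X :=
  exist (fun x : nat -> 'I_N.+1 => forall i, A (x i) (x i.+1) = 1%N)
    (fun i => letter x i.+1) (fun i => svalP x i.+1).

Lemma dtheta_shift (x y : X) : t * dtheta (shift x) (shift y) <= dtheta x y.
Proof.
have t0 : 0 < t by [].
rewrite -ler_pdivlMl//; apply: limr_le; first exact: is_cvg_dtheta.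
apply: nearW => n; rewrite ler_pdivlMl//.
have nd : nondecreasing_seq
    (series (fun i => t ^+ i * (letter x i != letter y i)%:R : R)).
  by apply/nondecreasing_series => k _ _; rewrite mulr_ge0// exprn_ge0// ltW.
have := nondecreasing_cvgn_le nd (@is_cvg_dtheta _ _ _ _ x y) n.+1.
apply: le_trans; rewrite /series/= big_nat_recl//= mulr_sumr.
under [leLHS]eq_bigr do rewrite mulrA -exprS.
by rewrite lerDr mulr_ge0// exprn_ge0// ltW.
Qed.

Lemma measurable_shift :
  measurable_fun [set: Borel X] (shift : Borel X -> Borel X).
Proof.
apply: (@measurability _ _ (Borel X) (Borel X) setT shift open) => //.
move=> _ [U oU <-].
rewrite setTI; apply: sub_sigma_algebra; move: oU.
rewrite !openE => oU x /oU; rewrite /interior -!nbhs_ballE => -[e /= e0 eU].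
exists (t * e); first by rewrite /= mulr_gt0.
move=> y; rewrite ballEmdist/= => xy; apply: eU; rewrite ballEmdist/=.
rewrite -(ltr_pM2l (_ : 0 < t))//; apply: le_lt_trans xy.
exact: dtheta_shift.
Qed.

End shift.

(* Versions of pushforward carrying the proof of measurability, so that their
   structures can be inferred. *)
Section pushforwards.
Context d1 d2 (T1 : measurableType d1) (T2 : measurableType d2) (R : realType).
Variable f : T1 -> T2.

Definition cpush (nu : {charge set T1 -> \bar R})
  & measurable_fun [set: T1] f : set T2 -> \bar R := pushforward nu f.

Definition mpush (nu : {finite_measure set T1 -> \bar R})
  & measurable_fun [set: T1] f : set T2 -> \bar R := pushforward nu f.

Variable mf : measurable_fun [set: T1] f.

Section cpush.
Variable nu : {charge set T1 -> \bar R}.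

HB.instance Definition _ :=
  Charge.copy (cpush nu mf) (measure_function_pushforward__canonical__charge_Charge nu mf).

End cpush.

Section mpush.
Variable nu : {finite_measure set T1 -> \bar R}.

HB.instance Definition _ := Measure.copy (mpush nu mf)
  (measure_function_pushforward__canonical__measure_function_Measure nu mf).

Let mpush_fin : fin_num_fun (mpush nu mf).
Proof.
move=> B mB; apply: fin_num_measure.
by rewrite -[X in measurable X]setTI; exact: mf.
Qed.

HB.instance Definition _ := @Measure_isFinite.Build _ _ _
  (mpush nu mf) mpush_fin.

End mpush.
End pushforwards.

Section signed_measures.
Context d (T : measurableType d) (R : realType).
Implicit Type nu : {charge set T -> \bar R}.

(* The parts nu^+ and nu^- of the Jordan decomposition do not depend on the
   Hahn decomposition that is chosen. *)
Definition hahn nu :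
    {PN : set T * set T | hahn_decomposition nu PN.1 PN.2} :=
  let P := cid (Hahn_decomposition nu) in
  let N := cid (svalP P) in
  exist _ (sval P, sval N) (svalP N).

Definition jpos nu : {finite_measure set T -> \bar R} :=
  jordan_pos (svalP (hahn nu)).

Definition jneg nu : {finite_measure set T -> \bar R} :=
  jordan_neg (svalP (hahn nu)).

Definition charge_integral nu (g : T -> R) : \bar R :=
  (\int[jpos nu]_x (g x)%:E - \int[jneg nu]_x (g x)%:E)%E.

End signed_measures.

Definition lipschitz_with (R : realType) (X : metricType R) (c : R)
    (f : X -> R) : Prop :=
  forall x y, `|f x - f y| <= c * mdist x y.

(* The least Lipschitz constant, +oo if there is none. *)
Definition lip_const (R : realType) (X : metricType R) (f : X -> R) : \bar R :=
  ereal_inf [set c%:E | c in [set c : R | 0 <= c /\ lipschitz_with c f]].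

Definition sup_norm (R : realType) (X : Type) (f : X -> R) : \bar R :=
  ereal_sup [set `|f x|%:E | x in [set: X]].

Definition diam (R : realType) (X : metricType R) : \bar R :=
  ereal_sup [set (mdist x y)%:E | x in [set: X] & y in [set: X]].

Definition wnorm (R : realType) (K : pmetricType R)
    (nu : {charge set (Borel K) -> \bar R}) : \bar R :=
  ereal_sup [set `|charge_integral nu g|%E |
    g in [set g : K -> R | lipschitz_with 1 g /\ forall y, `|g y| <= 1]].

Section markov_measure.
Context {R : realType} {N : nat} {A : aperiodic_matrix N}.
Context {theta : {itv R & `]0%Z, 1%Z[}}.
Local Notation X := (subshift A theta).

Definition stochastic_for (p : 'M[R]_N.+1) : Prop :=
  [/\ forall i j, 0 <= p i j, forall i, \sum_j p i j = 1 &
      forall i j, 0 < p i j <-> A i j = 1%N].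

Definition stationary (p : 'M[R]_N.+1) (q : 'rV[R]_N.+1) : Prop :=
  [/\ forall i, 0 <= q 0 i, \sum_i q 0 i = 1 & q *m p = q].

Definition markov_measure (m : probability (Borel X) R) : Prop :=
  exists (p : 'M[R]_N.+1) (q : 'rV[R]_N.+1),
    [/\ stochastic_for p, stationary p q &
      forall (n : nat) (a : nat -> 'I_N.+1),
        m [set x : X | forall i, (i <= n)%N -> letter x i = a i] =
        (q 0 (a 0%N) * \prod_(i < n) p (a i) (a i.+1))%:E].

End markov_measure.

Section skew_product.
Context {R : realType} {N : nat} {A : aperiodic_matrix N}.
Context {theta : {itv R & `]0%Z, 1%Z[}} {K : pmetricType R}.
Local Notation X := (subshift A theta).
(* For a compact K the two factors are second countable, so the product
   sigma-algebra is the Borel sigma-algebra of the product. *)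
Local Notation XK := (Borel X * Borel K)%type.
Local Notation mfst := (@measurable_fst _ _ (Borel X) (Borel K)).
Local Notation msnd := (@measurable_snd _ _ (Borel X) (Borel K)).
Implicit Types (mu : {charge set XK -> \bar R}) (G : XK -> Borel K).

Definition skew G (z : XK) : XK := (shift z.1, G z).

Lemma measurable_skew G :
  measurable_fun [set: XK] G -> measurable_fun [set: XK] (skew G).
Proof.
move=> mG; apply: measurable_fun_pair => //.
by apply: measurableT_comp => //; exact: measurable_shift.
Qed.

Definition Fstar G (mG : measurable_fun [set: XK] G) mu :
    {charge set XK -> \bar R} :=
  cpush mu (measurable_skew mG).

Definition leaf (x : X) : set XK := [set z | z.1 = x].

Variable m : probability (Borel X) R.

Definition AB mu : Prop :=
  mpush (jpos mu) mfst `<< m /\ mpush (jneg mu) mfst `<< m.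

Section positive.
Variable nu : {finite_measure set XK -> \bar R}.

Definition disintegration (kappa : Borel X -> probability XK R) : Prop :=
  [/\ {ae mpush nu mfst, forall x, kappa x (leaf x) = 1%E},
      forall E, measurable E -> measurable_fun [set: Borel X] (kappa ^~ E) &
      forall E, measurable E ->
        nu E = (\int[m]_x (kappa x E * ('d (mpush nu mfst) '/d m) x))%E].

Definition restriction (kappa : Borel X -> probability XK R) (x : Borel X) :
    {charge set (Borel K) -> \bar R} :=
  cscale (fine (('d (mpush nu mfst) '/d m) x))
    (charge_of_finite_measure (mpush (kappa x) msnd)).

End positive.

(* When mu is in AB, the two families exist by Rokhlin's theorem and the
   restrictions they define are unique up to m-null sets, so that the set below
   is a singleton. *)
Definition norm_infty mu : \bar R :=
  xget +oo%E [set e | exists kp kn,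
    [/\ disintegration (jpos mu) kp, disintegration (jneg mu) kn &
        e = ess_sup m (fun x => wnorm
              (cadd (restriction (jpos mu) kp x)
                    (copp (restriction (jneg mu) kn x))))]].

Definition Linfty mu : Prop := AB mu /\ (norm_infty mu < +oo)%E.

(* phi is a Lipschitz version of phi_1, which is only defined m-a.e.; since m
   charges every cylinder there is at most one. *)
Definition lipschitz_density mu (phi : X -> R) : Prop :=
  {ae m, forall x, ('d (cpush mu mfst) '/d m) x = (phi x)%:E} /\
  (lip_const phi < +oo)%E.

Definition Sinfty mu : Prop := Linfty mu /\ exists phi, lipschitz_density mu phi.

(* +oo when phi_1 has no Lipschitz version. *)
Definition density_norm mu : \bar R :=
  xget +oo%E [set (sup_norm phi + lip_const phi)%E |
    phi in [set phi | lipschitz_density mu phi]].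

Definition norm_Sinfty mu : \bar R := (density_norm mu + norm_infty mu)%E.

End skew_product.

(* Main.v *)
Require Import Defs.
From HB Require Import structures.
From mathcomp Require Import all_boot all_order all_algebra.
From mathcomp Require Import interval_inference finmap.
From mathcomp Require Import all_classical all_reals all_analysis.
From mathcomp Require Import measurable_realfun ess_sup_inf giry.
From mathcomp Require Import lra ring.

(** The norm of [F_* mu] is controlled by duality.  The norm of a measure on a
    fibre is a supremum over tests, the functions [g] on [K] with Lipschitz
    constant and sup norm at most 1.  As [K] is compact, countably many tests
    suffice, and so [norm_infty mu <= c] means that the integral of
    [g y * 1_E x] against [mu] is at most [c * m E] in absolute value for every
    test [g] and every Borel set [E]: this is [fiber_bound_dual] in one
    direction and [dual_bound_fiber] in the other.  In this form it is clear
    that [F_*] does not increase the norm ([Fstar_norm_infty]): to integrate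
    [g y * 1_E x] against [F_* mu] is to integrate
    [g (G (x, y)) * 1_E (shift x)] against [mu], the function [g (G (x, _))] is
    again a test for almost every [x] since the fibre maps are contractions, and
    [m] is invariant under the shift.

    The norm of [F_* mu] also presupposes that both Jordan parts of [F_* mu]
    can be disintegrated.  They are dominated by the images of the Jordan parts
    of [mu], and those are carried along by the backward kernel of the Markov
    chain, which from [x] goes to the preimage [i x] with probability
    [q_i p_(i x_0) / q_(x_0)].  This kernel leaves [m] invariant
    ([backward_invariant]), which turns a kernel [eta] from the base to [K] into
    a kernel [eta'] such that the image of the semidirect product of [m] and
    [eta] is the semidirect product of [m] and [eta'] ([semidirect_skew]).  A
    measure dominated by such a semidirect product is disintegrated by
    multiplying [eta' x] by a Radon-Nikodym density and normalising
    ([disintegration_of_dominated]).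

    The density [phi] of [mu] on the base evolves under the transfer operator
    [P phi x = \sum_i q_i p_(i x_0) / q_(x_0) * phi (i x)].  Its coefficients
    depend on [x_0] only.  For two points with the same first letter, prepending
    a letter multiplies the distance by [theta], and all other pairs of points
    are at distance at least 1; hence the Lipschitz constant of [P phi] is at
    most [theta * c + 2 * s] when that of [phi] is [c] and [s] bounds [phi]
    ([transfer_lipschitz]).  The constant test 1 shows that [s] may be taken to
    be [norm_infty mu] ([density_le_norm]); this bounds [phi] everywhere and
    not just almost everywhere because [m] charges every cylinder.  Iterating
    and summing a geometric series gives the theorem with [alpha1 = theta] and
    [B4 = 2 + 2 / (1 - theta)]. *)

Set Implicit Arguments.
Unset Strict Implicit.
Unset Printing Implicit Defensive.

Import Order.TTheory GRing.Theory Num.Theory.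
Import numFieldNormedType.Exports.
Local Open Scope classical_set_scope.
Local Open Scope ring_scope.
Local Open Scope charge_scope.
Local Notation shift := Defs.shift.

(** * Integration against finite signed measures *)

Section borel.
Context {R : realType} {K : pmetricType R}.

Lemma lipschitz_continuous (c : R) (g : K -> R) :
  lipschitz_with c g -> continuous g.
Proof.
move=> lg x; apply/cvgrPdist_lt => e e0.
have c1 : 0 < `|c| + 1 by rewrite ltr_wpDl.
have := nbhsx_ballx x (e / (`|c| + 1)) (divr_gt0 e0 c1).
apply: filterS => y; rewrite ballEmdist/= ltr_pdivlMr// => xy.
apply: le_lt_trans xy; apply: le_trans (lg x y) _.
rewrite mulrC ler_wpM2l ?mdist_ge0//.
by rewrite (le_trans (ler_norm c))// lerDl.
Qed.

Lemma continuous_Borel_measurable (g : K -> R) :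
  continuous g -> measurable_fun [set: Borel K] (g : Borel K -> R).
Proof.
move=> /continuousP cg.
apply: (measurability _ (RGenOpens.measurableE R)) => _ [_ [a [b ->]] <-].
rewrite setTI; apply: sub_sigma_algebra; apply: cg; exact: interval_open.
Qed.

Lemma lipschitz_Borel_measurable (c : R) (g : K -> R) :
  lipschitz_with c g -> measurable_fun [set: Borel K] (g : Borel K -> R).
Proof. by move=> /lipschitz_continuous /continuous_Borel_measurable. Qed.

End borel.

Lemma measurable_EFin_indic d (T : measurableType d) (R : realType)
    (B : set T) : measurable B ->
  measurable_fun [set: T] (fun x => (\1_B x)%:E : \bar R).
Proof. by move=> mB; exact/measurable_EFinP/measurable_indic. Qed.

Section bounded_integrals.
Context d (T : measurableType d) (R : realType).
Implicit Types (F : T -> R).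

Lemma bounded_integrable (nu : {finite_measure set T -> \bar R}) F (M : R) D :
  measurable D -> measurable_fun setT F -> (forall z, `|F z| <= M) ->
  nu.-integrable D (EFin \o F).
Proof.
move=> mD mF FM; apply: measurable_bounded_integrable => //.
- by rewrite ltey_eq fin_num_measure.
- exact: measurable_funTS.
- exists M; split; first by rewrite num_real.
  by move=> y My z _ /=; rewrite (le_trans (FM z))// ltW.
Qed.

(** Frees [charge_integral] from the Jordan decomposition: if
    [mu = nu1 - nu2], then [mu^+ + nu2 = mu^- + nu1] as measures, so both sides
    give the same integrals. *)
Lemma charge_integralE (mu : {charge set T -> \bar R})
    (nu1 nu2 : {finite_measure set T -> \bar R}) F (M : R) :
  (forall E, measurable E -> mu E = (nu1 E - nu2 E)%E) ->
  measurable_fun setT F -> (forall z, `|F z| <= M) ->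
  charge_integral mu F =
    (\int[nu1]_z (F z)%:E - \int[nu2]_z (F z)%:E)%E.
Proof.
move=> muE mF FM.
have iF (nu : {finite_measure set T -> \bar R}) :
    nu.-integrable setT (EFin \o F).
  exact: (bounded_integrable nu measurableT mF FM).
have finF (nu : {finite_measure set T -> \bar R}) :
    (\int[nu]_z (F z)%:E)%E \is a fin_num.
  exact: integrable_fin_num (iF nu).
have sumE E : measurable E ->
    measure_add (jpos mu) nu2 E = measure_add (jneg mu) nu1 E.
  move=> mE; rewrite !measure_addE.
  have := muE _ mE; rewrite (jordan_decomp (svalP (hahn mu)) mE).
  rewrite /cadd/= cscaleN1 -/(jpos mu) -/(jneg mu).
  have := fin_num_measure (jpos mu) _ mE.
  have := fin_num_measure (jneg mu) _ mE.
  have := fin_num_measure nu1 _ mE.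
  have := fin_num_measure nu2 _ mE.
  rewrite -/(jneg mu) /=.
  move=> /fineK <- /fineK <- /fineK <- /fineK <-.
  rewrite -!EFinB -!EFinD => -[] h; congr EFin; lra.
have : (\int[measure_add (jpos mu) nu2]_z (F z)%:E =
        \int[measure_add (jneg mu) nu1]_z (F z)%:E)%E.
  by apply: eq_measure_integral => E mE _; exact: sumE.
rewrite !integral_measure_add//; try exact: iF.
rewrite /charge_integral.
move: (finF (jpos mu)) (finF (jneg mu)) (finF nu1) (finF nu2).
move=> /fineK <- /fineK <- /fineK <- /fineK <-.
rewrite -!EFinD => -[] h; congr EFin; lra.
Qed.

End bounded_integrals.

(** * Kernels and semidirect products *)

Section mixture.
Context d1 d2 (T1 : measurableType d1) (T2 : measurableType d2) (R : realType).
Variables (mu : {measure set T1 -> \bar R}) (nu : {measure set T2 -> \bar R}).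
Variable k : T1 -> giry T2 R.
Hypothesis mk : measurable_fun [set: T1] k.
Hypothesis nuE : forall E, measurable E -> nu E = (\int[mu]_x k x E)%E.

Import HBNNSimple.

Let measurable_k_ev E : measurable E -> measurable_fun [set: T1] (k ^~ E).
Proof.
by move=> mE; apply: (measurableT_comp (measurable_giry_ev mE) mk).
Qed.

(** The identity [nu = \int k_x dmu(x)] between measures extends to integrals
    through simple functions and monotone convergence.  Here [mu] may be any
    measure, whereas [giry_bind] needs total mass at most 1. *)
Lemma integral_mixture (f : T2 -> \bar R) :
  measurable_fun [set: T2] f -> (forall y, 0 <= f y)%E ->
  (\int[nu]_y f y = \int[mu]_x giry_int (k x) f)%E.
Proof.
move=> mf f0.
have simple (h : {nnsfun T2 >-> R}) :
    (sintegral nu h = \int[mu]_x sintegral (k x) h)%E.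
  under eq_integral do rewrite sintegralE.
  rewrite ge0_integral_fsum//; last 2 first.
  - by move=> r; apply: measurable_funeM; exact: measurable_k_ev.
  - by move=> n x _; exact: nnsfun_mulemu_ge0.
  rewrite sintegralE; apply: eq_fsbigr => // r; rewrite inE => -[y _ <-].
  by rewrite ge0_integralZl ?nuE//; [exact: measurable_k_ev|rewrite lee_fin].
pose g := nnsfun_approx measurableT mf.
pose gE := fun n => EFin \o g n.
have mgE n : measurable_fun [set: T2] (gE n) by exact/measurable_EFinP.
have gE_ge0 n x : (0 <= gE n x)%E by rewrite lee_fin.
have nd_gE x : {homo gE ^~ x : n m / (n <= m)%O >-> (n <= m)%E}.
  by move=> *; exact/lefP/nd_nnsfun_approx.
transitivity (limn (fun n => \int[nu]_x gE n x))%E.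
  rewrite -monotone_convergence//; apply: eq_integral => t _.
  by apply/esym/cvg_lim => //; exact: cvg_nnsfun_approx.
transitivity (limn (fun n => \int[mu]_x \int[k x]_y gE n y))%E.
  apply: congr_lim; apply/funext => n.
  rewrite integralT_nnsfun simple; apply: eq_integral => x _.
  by rewrite integralT_nnsfun.
rewrite -[LHS]monotone_convergence//; last 3 first.
- move=> n; apply: (measurableT_comp (measurable_giry_int (mgE n) _) mk).
  exact: gE_ge0.
- by move=> n x _; exact: integral_ge0.
- by move=> x _ a b ab; apply: ge0_le_integral => // t _; exact: nd_gE.
apply: eq_integral => x _.
rewrite -monotone_convergence//.
apply: eq_integral => t _.
by apply/cvg_lim => //; exact: cvg_nnsfun_approx.
Qed.

End mixture.

Lemma giry_bindE d1 d2 (T1 : measurableType d1) (T2 : measurableType d2)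
    (R : realType) (mu : giry T1 R) (k : T1 -> giry T2 R)
    (mk : measurable_fun [set: T1] k) B : measurable B ->
  giry_bind mu mk B = (\int[mu]_x k x B)%E.
Proof.
move=> mB; rewrite -[LHS]/(giry_int (giry_map mk mu) (giry_ev ^~ B)).
by rewrite giry_int_map//; exact: measurable_giry_ev.
Qed.

Section semidirect.
Context d1 d2 (X : measurableType d1) (Y : measurableType d2) (R : realType).
Implicit Types (eta : X -> giry Y R) (f : X * Y -> \bar R).

(** The law [eta x] placed on the leaf above [x]; written as a product with a
    Dirac mass so that its measurability in [x] is inherited. *)
Definition along eta (x : X) : giry (X * Y)%type R :=
  giry_prod (giry_ret x, eta x).

Lemma measurable_along eta : measurable_fun [set: X] eta ->
  measurable_fun [set: X] (along eta).
Proof.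
move=> meta; apply: (measurableT_comp (@measurable_giry_prod _ _ X Y R)).
by apply: measurable_fun_pair => //; exact: measurable_giry_ret.
Qed.

Lemma giry_int_along eta x f : measurable_fun [set: X * Y] f ->
  (forall z, 0 <= f z)%E ->
  giry_int (along eta x) f = (\int[eta x]_y f (x, y))%E.
Proof.
move=> mf f0; rewrite /along giry_int_prod1// giry_int_ret//.
exact: (measurable_fun_fubini_tonelli_F (m2 := eta x)).
Qed.

Definition semidirect (m : giry X R) eta (meta : measurable_fun [set: X] eta) :
  giry (X * Y)%type R := giry_bind m (measurable_along meta).

Lemma integral_semidirect (m : giry X R) eta
    (meta : measurable_fun [set: X] eta) f :
  measurable_fun [set: X * Y] f -> (forall z, 0 <= f z)%E ->
  (\int[semidirect m meta]_z f z = \int[m]_x \int[eta x]_y f (x, y))%E.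
Proof.
move=> mf f0.
rewrite -[LHS]/(giry_int _ _) giry_int_bind//.
by apply: eq_integral => x _; rewrite giry_int_along.
Qed.

Lemma measurable_integral_fiber eta f : measurable_fun [set: X] eta ->
  measurable_fun [set: X * Y] f -> (forall z, 0 <= f z)%E ->
  measurable_fun [set: X] (fun x => \int[eta x]_y f (x, y))%E.
Proof.
move=> meta mf f0; under eq_fun do rewrite -giry_int_along//.
apply: (measurableT_comp (measurable_giry_int mf f0)).
exact: measurable_along.
Qed.

End semidirect.

(** * Disintegration of dominated measures *)

Section leafwise.
Context d1 d2 (X : measurableType d1) (Y : measurableType d2) (R : realType).

(** The probability [P] placed on the leaf above [x]: unlike [along], it
    carries its proof of total mass 1. *)
Definition leafwise (P : probability Y R) (x : X) : set (X * Y) -> \bar R :=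
  mpush P (pair1_measurable x).

HB.instance Definition _ P x := Measure.on (leafwise P x).

Let leafwise_setT P x : leafwise P x setT = 1%E.
Proof.
by rewrite /leafwise /mpush /pushforward preimage_setT; exact: probability_setT.
Qed.

HB.instance Definition _ P x :=
  Measure_isProbability.Build _ _ _ (leafwise P x) (@leafwise_setT P x).

End leafwise.

Section density_kernel.
Context d1 d2 (X : measurableType d1) (Y : measurableType d2) (R : realType).
Variables (eta : X -> giry Y R) (h : X * Y -> \bar R).
Hypotheses (meta : measurable_fun [set: X] eta)
  (mh : measurable_fun [set: X * Y] h) (h0 : forall z, (0 <= h z)%E).

Definition fiber_density (x : X) (B : set Y) : \bar R :=
  (\int[eta x]_(y in B) h (x, y))%E.

Let density0 x : fiber_density x set0 = 0%E.
Proof. by rewrite /fiber_density integral_set0. Qed.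

Let density_ge0 x B : (0 <= fiber_density x B)%E.
Proof. exact: integral_ge0. Qed.

Let measurable_h x : measurable_fun [set: Y] (fun y => h (x, y)).
Proof. exact: measurableT_comp (pair1_measurable x). Qed.

Let density_sigma_additive x : semi_sigma_additive (fiber_density x).
Proof.
move=> F mF tF mUF; rewrite /fiber_density ge0_integral_bigcup//; last first.
  exact: measurable_funTS.
by apply: is_cvg_ereal_nneg_natsum => n _; exact: integral_ge0.
Qed.

HB.instance Definition _ x := isMeasure.Build _ _ _ (fiber_density x)
  (density0 x) (density_ge0 x) (@density_sigma_additive x).

(** Takes the measurability of [eta] as an argument because the kernel
    structure, inferred from the term alone, depends on it. *)
Definition density_kernel & measurable_fun [set: X] eta :
  X -> {measure set Y -> \bar R} := fiber_density.

Lemma density_xsectionE x E : measurable E ->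
  fiber_density x (xsection E x) =
    (\int[eta x]_y (h (x, y) * (\1_E (x, y))%:E))%E.
Proof.
move=> mE; rewrite /fiber_density integral_mkcond epatch_indic.
by apply: eq_integral => y _ /=; rewrite !indicE mem_xsection.
Qed.

Lemma measurable_density_xsection E : measurable E ->
  measurable_fun [set: X] (fun x => fiber_density x (xsection E x)).
Proof.
move=> mE; under eq_fun do rewrite density_xsectionE//.
apply: (measurable_integral_fiber (f := fun z => h z * (\1_E z)%:E)%E) => //.
- by apply: emeasurable_funM => //; exact/measurable_EFinP/measurable_indic.
- by move=> z; rewrite mule_ge0// lee_fin.
Qed.

Let measurable_density B : measurable B ->
  measurable_fun [set: X] (density_kernel meta ^~ B).
Proof.
move=> mB.
have := measurable_density_xsection (measurableX (@measurableT _ X) mB).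
apply: eq_measurable_fun => x _; rewrite /density_kernel/=; congr fiber_density.
by rewrite in_xsectionX// inE.
Qed.

HB.instance Definition _ :=
  isKernel.Build _ _ _ _ _ (density_kernel meta) measurable_density.

End density_kernel.

Section disintegration_of_dominated.
Context d1 d2 (X : measurableType d1) (Y : measurableType d2) (R : realType).
Variable m : probability X R.
Variable nu : {finite_measure set (X * Y)%type -> \bar R}.
Variables (eta : X -> giry Y R) (meta : measurable_fun [set: X] eta).
Local Notation nu1 := (mpush nu (@measurable_fst _ _ X Y)).
Hypothesis dom : nu `<< semidirect (m : giry X R) meta.

(** If [h] is the density of [nu] with respect to the semidirect product, then
    [h (x, _) * eta x] is a disintegration of [nu] up to normalisation, and its
    total mass at [x] is the density of the marginal.  That mass is almost
    everywhere finite; where it is 0 or infinite the normalised measure is an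
    arbitrary Dirac mass, harmless since it is multiplied by the density 0 or
    occurs on a null set only. *)
Lemma disintegration_of_dominated : exists P : X -> probability Y R,
  (forall E, measurable E ->
    measurable_fun [set: X] (fun x => leafwise (P x) x E)) /\
  forall E, measurable E ->
    nu E = (\int[m]_x (leafwise (P x) x E * ('d nu1 '/d m) x))%E.
Proof.
pose L := semidirect (m : giry X R) meta.
pose h := Radon_Nikodym_SigmaFinite.f nu L.
have h0 z : (0 <= h z)%E by exact: Radon_Nikodym_SigmaFinite.f_ge0.
have ih : L.-integrable setT h by exact: Radon_Nikodym_SigmaFinite.f_integrable.
have mh : measurable_fun setT h := measurable_int _ ih.
pose k := density_kernel mh h0 meta.
have nuE E : measurable E -> nu E = (\int[m]_x k x (xsection E x))%E.
  move=> mE.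
  rewrite [LHS](Radon_Nikodym_SigmaFinite.f_integral dom mE).
  rewrite integral_mkcond epatch_indic -/h integral_semidirect//; last 2 first.
  - by apply: emeasurable_funM => //; exact/measurable_EFinP/measurable_indic.
  - by move=> z /=; rewrite mule_ge0// lee_fin.
  by apply: eq_integral => x _; rewrite /k/= density_xsectionE.
pose Z x := k x setT.
have mZ : measurable_fun setT Z by exact: measurable_kernel.
have Z0 x : (0 <= Z x)%E by [].
have nu1E B : measurable B -> nu1 B = (\int[m]_(x in B) Z x)%E.
  move=> mB; rewrite /mpush /pushforward nuE; last first.
    by rewrite -[X in measurable X]setTI; exact: measurable_fst.
  rewrite [RHS]integral_mkcond; apply: eq_integral => x _; rewrite patchE.
  have -> : fst @^-1` B = B `*` [set: Y].
    by apply/seteqP; split => [z|z []].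
  case: ifPn => xB; first by rewrite in_xsectionX.
  by rewrite notin_xsectionX// measure0.
have nu1m : nu1 `<< m.
  apply/null_content_dominatesP => B mB mB0; rewrite nu1E//.
  by rewrite null_set_integral//; exact: measurable_funTS.
have iZ : m.-integrable setT Z.
  apply/integrableP; split => //.
  under eq_integral do rewrite gee0_abs//.
  by rewrite -nu1E// ltey_eq fin_num_measure.
have dE : ae_eq m setT Z ('d nu1 '/d m).
  apply: integral_ae_eq => // B _ mB.
  by rewrite -nu1E// -Radon_Nikodym_integral.
pose P x : probability Y R := mnormalize (k x) (dirac point).
have mP B : measurable B -> measurable_fun setT (P ^~ B).
  by move=> mB; exact: (measurable_kernel (knormalize k (dirac point))).
have leafE x E : leafwise (P x) x E = P x (xsection E x).
  by rewrite xsectionE.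
have mleaf E : measurable E ->
    measurable_fun setT (fun x => leafwise (P x) x E).
  move=> mE.
  have mP' : measurable_fun setT (P : X -> giry Y R).
    exact: measurable_giry_codensity.
  have /(_ _ _)/eq_measurable_fun :=
    measurable_integral_fiber mP' (f := EFin \o \1_E).
  apply => //.
  + move=> x _ /=; rewrite leafE -[in RHS](setIT (xsection E x)).
    rewrite -integral_indic//.
      by apply: eq_integral => y _; rewrite !indicE mem_xsection.
    exact: measurable_xsection.
  + exact/measurable_EFinP/measurable_indic.
  + by move=> z; rewrite lee_fin.
exists P; split=> // E mE; rewrite nuE//.
apply: ae_eq_integral => //.
- exact: measurable_density_xsection.
- by apply: emeasurable_funM => //; exact: mleaf.
near=> x => _.
have <- : Z x = ('d nu1 '/d m) x by near: x; apply: filterS dE => x; apply.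
have Zfin : Z x \is a fin_num.
  by near: x; apply: filterS (integrable_ae measurableT iZ) => x; apply.
rewrite leafE.
have -> : P x (xsection E x) = (if (Z x == 0) || (Z x == +oo) then
    \d_point (xsection E x) else k x (xsection E x) * (fine (Z x))^-1%:E)%E.
  by rewrite /P /= /mnormalize; case: ifP.
have [Zx0|Zx0] /= := eqVneq (Z x) 0%E.
  rewrite Zx0 mule0; apply/eqP; rewrite eq_le; apply/andP; split.
    by rewrite -Zx0 le_measure ?inE//; exact: measurable_xsection.
  exact: measure_ge0.
have -> /= : (Z x == +oo)%E = false by apply/negbTE; case: (Z x) Zfin.
rewrite -muleA; move: (Z x) Zfin Zx0 => [z _ z0|//|//] /=.
by rewrite -EFinM mulVf ?mule1//; move: z0; rewrite eqe.
Unshelve. all: by end_near.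
Qed.

End disintegration_of_dominated.

(** * Integration along the leaves *)

Section disintegrations.
Context {R : realType} {N : nat} {A : aperiodic_matrix N}.
Context {theta : {itv R & `]0%Z, 1%Z[}} {K : pmetricType R}.
Local Notation X := (subshift A theta).
Local Notation XK := (Borel X * Borel K)%type.
Local Notation mfst := (@measurable_fst _ _ (Borel X) (Borel K)).
Local Notation msnd := (@measurable_snd _ _ (Borel X) (Borel K)).
Variable m : probability (Borel X) R.
Variable nu : {finite_measure set XK -> \bar R}.
Local Notation nu1 := (mpush nu mfst).

(** A kernel into [K] gives fibre measures carried by their leaf for every [x],
    which settles the condition on leaves in the definition. *)
Lemma disintegration_exists (eta : Borel X -> giry (Borel K) R)
    (meta : measurable_fun setT eta) :
  nu `<< semidirect (m : giry (Borel X) R) meta ->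
  exists kappa, disintegration m nu kappa.
Proof.
move=> /disintegration_of_dominated[P [mP nuE]].
exists (fun x => leafwise (P x) x); split => //.
apply: aeW => x.
rewrite -[LHS]/(P x (pair x @^-1` leaf x)).
have -> : pair x @^-1` (leaf x : set XK) = setT by apply/seteqP; split.
exact: probability_setT.
Qed.

Lemma measurable_leaf (x : X) : measurable (leaf x : set XK).
Proof.
have mx : measurable ([set x] : set (Borel X)).
  rewrite -[[set x]]setCK; apply: measurableC; apply: sub_sigma_algebra.
  rewrite openC; apply: accessible_closed_set1.
  exact/hausdorff_accessible/metric_hausdorff.
by have := mfst measurableT _ mx; rewrite setTI.
Qed.

Variable kappa : Borel X -> probability XK R.
Hypothesis nuk : disintegration m nu kappa.
Hypothesis nu1m : nu1 `<< m.

Let mkappa : measurable_fun setT (kappa : Borel X -> giry XK R).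
Proof. by case: nuk => _ mk _; exact: measurable_giry_codensity. Qed.

(** The fibre measures seen as laws on [K]: these can be used for every [x],
    whereas [kappa x] is carried by its leaf for almost every [x] only. *)
Definition fiber_law (x : Borel X) : giry (Borel K) R :=
  giry_map msnd (kappa x : giry XK R).

Lemma measurable_fiber_law : measurable_fun setT fiber_law.
Proof. exact: (measurableT_comp (measurable_giry_map msnd) mkappa). Qed.

(** The version of the density that is nonnegative and finite everywhere. *)
Definition marginal_density : Borel X -> \bar R :=
  Radon_Nikodym_SigmaFinite.f nu1 m.

Lemma marginal_density_ge0 x : (0 <= marginal_density x)%E.
Proof. exact: Radon_Nikodym_SigmaFinite.f_ge0. Qed.

Lemma marginal_density_fin x : marginal_density x \is a fin_num.
Proof. exact: Radon_Nikodym_SigmaFinite.f_fin_num. Qed.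

Lemma marginal_density_integrable : m.-integrable setT marginal_density.
Proof. exact: Radon_Nikodym_SigmaFinite.f_integrable. Qed.

Lemma marginal_densityE : ae_eq m setT ('d nu1 '/d m) marginal_density.
Proof.
apply: integral_ae_eq => //.
- exact: Radon_Nikodym_integrable.
- exact: measurable_int _ marginal_density_integrable.
move=> B _ mB.
rewrite -Radon_Nikodym_integral//.
by rewrite -[RHS]Radon_Nikodym_SigmaFinite.f_integral.
Qed.

(** [kappa x] lives on the leaf above [x], where [z = (x, z.2)]. *)
Lemma integral_fiber_law x (f : XK -> \bar R) : kappa x (leaf x) = 1%E ->
  measurable_fun setT f -> (forall z, 0 <= f z)%E ->
  (\int[kappa x]_z f z = \int[fiber_law x]_y f (x, y))%E.
Proof.
move=> kx mf f0.
rewrite -[RHS]/(giry_int (giry_map msnd (kappa x : giry XK R))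
  (fun y => f (x, y))).
have mfx : measurable_fun setT (fun y : Borel K => f (x, y)).
  exact: measurableT_comp (pair1_measurable x).
have kC : kappa x (~` leaf x) = 0%E.
  by rewrite probability_setC ?kx ?subee//; exact: measurable_leaf.
rewrite giry_int_map//.
apply: ae_eq_integral => //; first exact: (measurableT_comp mfx msnd).
exists (~` leaf x); split.
- by apply: measurableC; exact: measurable_leaf.
- exact: kC.
- by move=> -[x' y] /=; apply: contra_not; rewrite /leaf /= => -> _.
Qed.

(** Combines the mixture over the marginal with the change of variables from the
    marginal to its density with respect to [m]. *)
Lemma ge0_integral_disintegration (f : XK -> \bar R) :
  measurable_fun setT f -> (forall z, 0 <= f z)%E ->
  (\int[nu]_z f z =
   \int[m]_x ((\int[fiber_law x]_y f (x, y)) * marginal_density x))%E.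
Proof.
move=> mf f0; have [kleaf mk nuE] := nuk.
have mfl := measurable_integral_fiber measurable_fiber_law mf f0.
rewrite (Radon_Nikodym_SigmaFinite.change_of_variables nu1m)//; last first.
  by move=> x; exact: integral_ge0.
rewrite (@integral_mixture _ _ _ _ _ nu1 nu kappa mkappa)//; last first.
  move=> E mE.
  transitivity (\int[m]_x (kappa x E * ('d nu1 '/d m) x))%E; first exact: nuE.
  rewrite -(Radon_Nikodym_SigmaFinite.change_of_variables nu1m)//.
  - apply: ae_eq_integral => //.
    + by apply: emeasurable_funM => //; exact: mk.
    + apply: emeasurable_funM; first exact: mk.
      exact: measurable_int _ marginal_density_integrable.
    + by apply: filterS marginal_densityE => x /(_ I) -> _.
  - exact: mk.
apply: ae_eq_integral => //.
  exact: (measurableT_comp (measurable_giry_int mf f0) mkappa).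
by apply: filterS kleaf => x kx _; rewrite -integral_fiber_law.
Qed.

(** Converse of [disintegration_exists]: domination by a semidirect product
    characterises the measures that can be disintegrated, and is the form in
    which this property is propagated by the skew product. *)
Lemma disintegration_dominated :
  nu `<< semidirect (m : giry (Borel X) R) measurable_fiber_law.
Proof.
apply/null_content_dominatesP => E mE E0.
have mI : measurable_fun setT (EFin \o \1_E : XK -> \bar R).
  exact/measurable_EFinP/measurable_indic.
have I0 z : (0 <= (EFin \o \1_E) z :> \bar R)%E by rewrite lee_fin.
rewrite -(setIT E) -integral_indic// (ge0_integral_disintegration mI I0).
have := integral_semidirect (m : giry _ R) measurable_fiber_law mI I0.
rewrite integral_indic// setIT [LHS]E0 => /esym intE0.
have mF := measurable_integral_fiber measurable_fiber_law mI I0.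
have F0 x : (0 <= \int[fiber_law x]_y (EFin \o \1_E) (x, y))%E.
  exact: integral_ge0.
have Fae : ae_eq m setT (fun x => \int[fiber_law x]_y (EFin \o \1_E) (x, y))%E
    (cst 0%E).
  apply/ae_eq_integral_abs => //.
  rewrite -[RHS]intE0; apply: eq_integral => x _; exact: (gee0_abs (F0 x)).
rewrite (ae_eq_integral (cst 0%E)) ?integral0//.
- apply: emeasurable_funM => //.
  exact: measurable_int _ marginal_density_integrable.
- by apply: filterS Fae => x /(_ I) /= -> _; rewrite mul0e.
Qed.

Section bounded.
Variables (F : XK -> R) (M : R).
Hypotheses (mF : measurable_fun setT F) (FM : forall z, `|F z| <= M).

Let mF' : measurable_fun setT (EFin \o F). Proof. exact/measurable_EFinP. Qed.

Let disintegrable (g : XK -> \bar R) : measurable_fun setT g ->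
  (forall z, 0 <= g z)%E -> nu.-integrable setT g ->
  m.-integrable setT
    (fun x => (\int[fiber_law x]_y g (x, y)) * marginal_density x)%E.
Proof.
move=> mg g0 /integrableP[_].
rewrite (eq_integral g) => [|z _]; last exact: (gee0_abs (g0 z)).
rewrite (ge0_integral_disintegration mg g0) => glty; apply/integrableP; split.
  apply: emeasurable_funM.
    exact: (measurable_integral_fiber measurable_fiber_law mg g0).
  exact: measurable_int _ marginal_density_integrable.
apply: le_lt_trans glty; rewrite le_eqVlt; apply/orP; left; apply/eqP.
apply: eq_integral => x _; rewrite gee0_abs//.
by apply: mule_ge0; [exact: integral_ge0|exact: marginal_density_ge0].
Qed.

Let fiberE x : ((\int[fiber_law x]_y (F (x, y))%:E) * marginal_density x =
   (\int[fiber_law x]_y ((EFin \o F)^\+ (x, y))) * marginal_density x -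
   (\int[fiber_law x]_y ((EFin \o F)^\- (x, y))) * marginal_density x)%E.
Proof.
have iFx : (fiber_law x).-integrable setT (EFin \o (fun y => F (x, y))).
  apply: (bounded_integrable (fiber_law x) measurableT _ (fun y => FM (x, y))).
  exact: measurableT_comp (pair1_measurable x).
rewrite [in LHS]integralE muleBl ?marginal_density_fin//; last first.
  apply: fin_num_adde_defr; apply: integrable_fin_num => //.
  exact: integrable_funepos.
congr (_ * _ - _ * _)%E; apply: eq_integral => y _.
  by rewrite !funeposE.
by rewrite !funenegE.
Qed.

Lemma integrable_disintegration : m.-integrable setT
  (fun x => (\int[fiber_law x]_y (F (x, y))%:E) * marginal_density x)%E.
Proof.
have iF := bounded_integrable nu measurableT mF FM.
under eq_fun do rewrite fiberE.
apply: integrableB => //; apply: disintegrable => //.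
- exact: measurable_funepos.
- exact: integrable_funepos.
- exact: measurable_funeneg.
- exact: integrable_funeneg.
Qed.

Lemma integral_disintegration : (\int[nu]_z (F z)%:E =
  \int[m]_x ((\int[fiber_law x]_y (F (x, y))%:E) * marginal_density x))%E.
Proof.
have iF := bounded_integrable nu measurableT mF FM.
under [RHS]eq_integral do rewrite fiberE.
rewrite integralB//; last 2 first.
- apply: disintegrable => //; first exact: measurable_funepos.
  exact: integrable_funepos.
- apply: disintegrable => //; first exact: measurable_funeneg.
  exact: integrable_funeneg.
rewrite [LHS]integralE (ge0_integral_disintegration (measurable_funepos mF'))//.
by rewrite (ge0_integral_disintegration (measurable_funeneg mF')).
Qed.

End bounded.

End disintegrations.

(** * Cylinders of the subshift *)

Section cylinders.
Context {R : realType} {N : nat} {A : aperiodic_matrix N}.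
Context {theta : {itv R & `]0%Z, 1%Z[}}.
Local Notation X := (subshift A theta).
Local Notation t := (theta%:num).

Let t0 : 0 < t. Proof. by []. Qed.
Let t1 : t < 1. Proof. by []. Qed.

Local Notation u x y :=
  (fun i : nat => t ^+ i * (letter (x : X) i != letter (y : X) i)%:R : R).

Lemma dtheta_ub (x y : X) M : (forall n, series (u x y) n <= M) ->
  dtheta x y <= M.
Proof.
by move=> xyM; apply: limr_le; [exact: is_cvg_dtheta|exact: nearW].
Qed.

Lemma dtheta_bounded (x y : X) : dtheta x y <= (1 - t)^-1.
Proof.
apply: dtheta_ub => n; elim: n x y => [|n IH] x y.
  by rewrite /series/= big_geq// invr_ge0 subr_ge0 ltW.
rewrite /series/= big_nat_recl//= expr0 mul1r.
under eq_bigr do rewrite exprS -mulrA.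
rewrite -mulr_sumr.
apply: (@le_trans _ _ (1 + t * (1 - t)^-1)).
  apply: lerD; first by rewrite lern1 leq_b1.
  by rewrite ler_wpM2l ?(ltW t0)//; have := IH (shift x) (shift y).
have n0 : 1 - t != 0 by rewrite subr_eq0 gt_eqF.
by rewrite -[in X in X + _ <= _](mulfV n0) -mulrDl subrK mul1r.
Qed.

(** The first term of the series vanishes and the others are those of the
    shifted points with a factor [theta]. *)
Lemma dtheta_shift_le (x y : X) : letter x 0 = letter y 0 ->
  dtheta x y <= t * dtheta (shift x) (shift y).
Proof.
move=> xy0; apply: dtheta_ub => -[|n].
  rewrite /series/= big_geq// mulr_ge0 ?(ltW t0)//.
  exact: (mdist_ge0 (shift x) (shift y)).
rewrite /series/= big_nat_recl//= xy0 eqxx mulr0 add0r.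
under eq_bigr do rewrite exprS -mulrA.
rewrite -mulr_sumr ler_wpM2l ?(ltW t0)//.
have nd : nondecreasing_seq (series (u (shift x) (shift y))).
  by apply/nondecreasing_series => k _ _; rewrite mulr_ge0// exprn_ge0// ltW.
have cv := @is_cvg_dtheta _ _ _ _ (shift x) (shift y).
exact: (nondecreasing_cvgn_le nd cv n).
Qed.

Lemma dtheta_agree (x y : X) n :
  (forall i, (i < n)%N -> letter x i = letter y i) ->
  dtheta x y <= t ^+ n * (1 - t)^-1.
Proof.
elim: n x y => [|n IH] x y xy; first by rewrite expr0 mul1r dtheta_bounded.
apply: le_trans (dtheta_shift_le (xy 0%N isT)) _.
rewrite exprS -mulrA ler_wpM2l ?(ltW t0)//.
by apply: IH => i ni; exact: xy.
Qed.

(** The empty word is allowed: it makes the whole space a cylinder, as the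
    uniqueness of measures requires. *)
Definition cylinder (s : seq 'I_N.+1) : set X :=
  [set x | mkseq (letter x) (size s) = s].

Lemma cylinderP s x : cylinder s x <->
  forall i, (i < size s)%N -> letter x i = nth ord0 s i.
Proof.
split=> [<- i|xs].
  by rewrite size_mkseq => si; rewrite nth_mkseq.
apply: (@eq_from_nth _ ord0); rewrite size_mkseq// => i si.
by rewrite nth_mkseq// xs.
Qed.

Lemma cylinder_nil : cylinder [::] = setT.
Proof. by apply/seteqP; split. Qed.

Lemma cylinder_prefix (x : X) n : cylinder (mkseq (letter x) n) x.
Proof. by rewrite /cylinder/= size_mkseq. Qed.

Lemma cylinder_cons a s x :
  cylinder (a :: s) x <-> letter x 0 = a /\ cylinder s (shift x).
Proof.
split => [/cylinderP xs|[x0 /cylinderP xs]].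
  split; first exact: (xs 0%N).
  by apply/cylinderP => i si; exact: (xs i.+1).
by apply/cylinderP => -[//|i] si; exact: xs.
Qed.

Lemma mdist_subshiftE (x y : X) : mdist x y = dtheta x y.
Proof. by []. Qed.

Lemma open_cylinder s : open (cylinder s).
Proof.
rewrite openE => x /cylinderP xs; rewrite /interior -nbhs_ballE.
exists (t ^+ size s) => /=; first exact: exprn_gt0.
move=> y; rewrite ballEmdist/= mdist_subshiftE => xy; apply/cylinderP => i si.
rewrite -xs//; apply/eqP; rewrite eq_sym; apply: contraTT xy => /dtheta_ge xy.
rewrite -leNgt; apply: le_trans xy; rewrite ler_wiXn2l ?(ltW t0) ?(ltW t1)//.
exact: ltnW.
Qed.

Lemma measurable_cylinder s : measurable (cylinder s : set (Borel X)).
Proof. by apply: sub_sigma_algebra; exact: open_cylinder. Qed.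

Lemma cylinder_small (x : X) (e : R) : 0 < e ->
  exists n, cylinder (mkseq (letter x) n) `<=` ball x e.
Proof.
move=> e0.
have : (t ^+ n * (1 - t)^-1) @[n --> \oo] --> 0.
  rewrite -(mul0r (1 - t)^-1); apply: cvgMl; apply: cvg_expr.
  by rewrite gtr0_norm.
move=> /cvgrPdist_lt /(_ _ e0)[n _ /(_ n (leqnn n))]/=.
rewrite sub0r normrN ger0_norm; last first.
  by rewrite mulr_ge0 ?exprn_ge0 ?invr_ge0 ?subr_ge0 ?(ltW t0) ?(ltW t1).
move=> tn; exists n => y /cylinderP; rewrite size_mkseq => xy.
rewrite ballEmdist/= mdist_subshiftE; apply: le_lt_trans tn.
by apply: dtheta_agree => i ni; rewrite xy// nth_mkseq.
Qed.

Definition cylinders : set (set (Borel X)) :=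
  [set B | B = set0 \/ exists s, B = cylinder s].

(** Every open set is the union of the cylinders that it contains, and there are
    countably many words. *)
Lemma cylinders_generate : @measurable _ (Borel X) = <<s cylinders >>.
Proof.
apply/seteqP; split.
  apply: smallest_sub; first exact: smallest_sigma_algebra.
  move=> U oU.
  have -> : U = \bigcup_(s : seq 'I_N.+1)
      (if `[< cylinder s `<=` U >] then cylinder s else set0).
    apply/seteqP; split => [x Ux|x [s _]]; last first.
      by case: asboolP => // sU /sU.
    move: (oU); rewrite openE => /(_ _ Ux); rewrite /interior -nbhs_ballE.
    move=> [e /= e0 eU]; have [n xn] := cylinder_small x e0.
    exists (mkseq (letter (x : X)) n) => //; case: asboolP => [_|[]].
      exact: cylinder_prefix.
    exact: subset_trans eU.
  apply: (@countable_bigcupT_measurable _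
    (g_sigma_algebraType cylinders)) => // s.
  case: ifP => _; last exact: measurable0.
  by apply: sub_sigma_algebra; right; exists s.
apply: smallest_sub; first exact: sigma_algebra_measurable.
move=> B [->|[s ->]]; [exact: measurable0|exact: measurable_cylinder].
Qed.

(** Two cylinders are nested or disjoint. *)
Lemma cylinders_setI : setI_closed cylinders.
Proof.
move=> B C [->|[s ->]]; first by rewrite set0I; left.
move=> [->|[s' ->]]; first by rewrite setI0; left.
wlog ss' : s s' / (size s <= size s')%N.
  move=> wlg; case: (leqP (size s) (size s')) => [/wlg //|/ltnW /wlg].
  by rewrite setIC.
have [xss'|no] :=
  pselect (forall i, (i < size s)%N -> nth ord0 s i = nth ord0 s' i).
  right; exists s'; apply/seteqP; split => [x [_]//|x xs']; split => //.
  move/cylinderP : xs' => xs'; apply/cylinderP => i si.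
  by rewrite xss'// xs'// (leq_trans si).
left; apply/seteqP; split => // x [/cylinderP xs /cylinderP xs'].
apply: no => i si.
by rewrite -xs// xs'// (leq_trans si).
Qed.

Lemma measure_unique_cylinders (m1 m2 : {measure set (Borel X) -> \bar R}) :
  (m1 setT < +oo)%E -> (forall s, m1 (cylinder s) = m2 (cylinder s)) ->
  forall B, measurable B -> m1 B = m2 B.
Proof.
move=> m1oo m12.
apply: (measure_unique cylinders (fun=> setT)) => //.
- exact: cylinders_generate.
- exact: cylinders_setI.
- by move=> _; right; exists [::]; rewrite cylinder_nil.
- exact: bigcup_const.
- by move=> B [->|[s ->]]; [rewrite !measure0|exact: m12].
Qed.

End cylinders.

(** * The backward kernel of the Markov chain *)

Section markov.
Context {R : realType} {N : nat} {A : aperiodic_matrix N}.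
Context {theta : {itv R & `]0%Z, 1%Z[}}.
Local Notation X := (subshift A theta).
Local Notation I := 'I_N.+1.
Variables (m : probability (Borel X) R) (p : 'M[R]_N.+1) (q : 'rV[R]_N.+1).
Hypotheses (hp : stochastic_for (A := A) p) (hq : stationary p q).
Hypothesis hm : forall (n : nat) (a : nat -> I),
  m [set x : X | forall i, (i <= n)%N -> letter x i = a i] =
  (q 0 (a 0%N) * \prod_(i < n) p (a i) (a i.+1))%:E.

Let p_ge0 i j : 0 <= p i j. Proof. by case: hp. Qed.
Let q_ge0 i : 0 <= q 0 i. Proof. by case: hq. Qed.

Lemma stochastic_power_gt0 k i j :
  (0 < (transition A ^+ k) i j)%N -> 0 < (p ^+ k) i j.
Proof.
have pk_ge0 l i' j' : 0 <= (p ^+ l) i' j'.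
  elim: l i' j' => [|l IH] i' j'; first by rewrite expr0 mxE ler0n.
  by rewrite exprS mxE; apply: sumr_ge0 => h _; rewrite mulr_ge0.
elim: k i j => [|k IH] i j.
  by rewrite !expr0 !mxE; case: (i == j); rewrite ?ltr01.
rewrite !exprS !mxE => Aij.
have [h Ahj] : exists h, (0 < transition A i h * (transition A ^+ k) h j)%N.
  apply: contrapT => /forallNP no; move: Aij; rewrite big1// => h _.
  by apply/eqP; rewrite -leqn0 leqNgt; apply/negP.
move: Ahj; rewrite muln_gt0 => /andP[Aih Ahj].
rewrite (bigD1 h)//= ltr_wpDr//.
  by apply: sumr_ge0 => l _; rewrite mulr_ge0.
rewrite mulr_gt0 ?IH//; case: hp => _ _ -> //.
by case/orP: (transition01 A i h) Aih => /eqP ->.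
Qed.

(** Some power [p ^+ k] has positive entries and [q = q *m p ^+ k], so the mass
    of any one letter reaches all the others. *)
Lemma stationary_gt0 j : 0 < q 0 j.
Proof.
case: hq => _ q1 qp; have [k [_ Ak]] := transition_aperiodic A.
have qpk : q *m p ^+ k = q.
  by elim: k {Ak} => [|k IH]; [rewrite mulmx1|rewrite exprS mulmxA qp].
have [i qi] : exists i, 0 < q 0 i.
  apply: contrapT => /forallNP no; move: q1; rewrite big1 => [/eqP|i _].
    by rewrite eq_sym oner_eq0.
  by apply/eqP; rewrite eq_le q_ge0 andbT leNgt; apply/negP.
rewrite -qpk mxE (bigD1 i)//= ltr_wpDr//.
  by apply: sumr_ge0 => l _; rewrite mulr_ge0// ltW// stochastic_power_gt0.
by rewrite mulr_gt0// stochastic_power_gt0.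
Qed.

Lemma markov_cylinder (a : I) s :
  m (cylinder (a :: s)) =
    (q 0 a * \prod_(i < size s) p (nth ord0 (a :: s) i) (nth ord0 s i))%:E.
Proof.
rewrite -(hm (size s) (nth ord0 (a :: s))); congr (m _).
apply/seteqP; split=> x /=.
  by move/cylinderP => xs i si; exact: xs.
by move=> xs; apply/cylinderP => i si; exact: xs.
Qed.

Lemma markov_cylinder1 (a : I) : m (cylinder [:: a]) = (q 0 a)%:E.
Proof. by rewrite markov_cylinder big_ord0 mulr1. Qed.

(** Transition probability of the time-reversed chain from [b] to [i]. *)
Definition weight (i b : I) : R := q 0 i * p i b / q 0 b.

Lemma weight_ge0 i b : 0 <= weight i b.
Proof. by rewrite /weight divr_ge0// mulr_ge0. Qed.

(** This is the stationarity of [q], column by column. *)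
Lemma sum_weight b : \sum_i weight i b = 1.
Proof.
rewrite -mulr_suml; case: hq => _ _ /rowP /(_ b); rewrite mxE => ->.
by rewrite divff// gt_eqF// stationary_gt0.
Qed.

Lemma weight0 i b : A i b <> 1%N -> weight i b = 0.
Proof.
move=> Aib; rewrite /weight; case: hp => _ _ /(_ i b) pib.
suff -> : p i b = 0 by rewrite mulr0 mul0r.
by apply/eqP; rewrite eq_le p_ge0 andbT leNgt; apply/negP => /pib.
Qed.

Lemma markov_cylinder2 (a b : I) s :
  m (cylinder [:: a, b & s]) = ((weight a b)%:E * m (cylinder (b :: s)))%E.
Proof.
rewrite !markov_cylinder -EFinM; congr EFin.
rewrite big_ord_recl /= mulrA [RHS]mulrA; congr (_ * _).
by rewrite /weight divfK// gt_eqF// stationary_gt0.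
Qed.

Lemma cylinder_gt0 (x : X) n : (0 < m (cylinder (mkseq (letter x) n)))%E.
Proof.
case: n => [|n].
  have -> : cylinder (mkseq (letter x) 0) = [set: X] by apply/seteqP; split.
  by rewrite probability_setT.
have -> : (cylinder (mkseq (letter x) n.+1) : set X) =
    [set y : X | forall i, (i <= n)%N -> letter y i = letter x i].
  apply/seteqP; split => y /=.
    by move/cylinderP; rewrite size_mkseq => xy i ni; rewrite xy// nth_mkseq.
  move=> xy; apply/cylinderP => i; rewrite size_mkseq => ni.
  by rewrite nth_mkseq// xy.
rewrite hm lte_fin mulr_gt0 ?stationary_gt0// prodr_gt0// => i _.
by case: hp => _ _ ->; exact: (svalP x).
Qed.

Definition cons_point (i : I) (x : X) (Aix : A i (letter x 0) = 1%N) : X :=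
  exist (fun x : nat -> I => forall i, A (x i) (x i.+1) = 1%N)
    (fun n => if n is n'.+1 then letter x n' else i)
    (fun n => match n with 0%N => Aix | n'.+1 => svalP x n' end).

(** The value at inadmissible pairs is chosen to keep [prepend i] continuous;
    these pairs always come with the weight 0. *)
Definition prepend (i : I) (x : X) : X :=
  match pselect (A i (letter x 0) = 1%N) with
  | left Aix => cons_point Aix
  | right _ => x
  end.

Lemma shift_prepend i x : A i (letter x 0) = 1%N -> shift (prepend i x) = x.
Proof.
by rewrite /prepend; case: pselect => // Aix _; exact: subshift_inj.
Qed.

Lemma letter0_prepend i x :
  A i (letter x 0) = 1%N -> letter (prepend i x) 0 = i.
Proof. by rewrite /prepend; case: pselect. Qed.

Lemma dtheta_lt1 (x y : X) : dtheta x y < 1 -> letter x 0 = letter y 0.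
Proof.
move=> xy; apply/eqP; apply: contraTT xy => /dtheta_ge.
by rewrite expr0 leNgt.
Qed.

Lemma dtheta_prepend i (x y : X) : letter x 0 = letter y 0 ->
  A i (letter x 0) = 1%N ->
  dtheta (prepend i x) (prepend i y) <= theta%:num * dtheta x y.
Proof.
move=> xy Aix; have Aiy : A i (letter y 0) = 1%N by rewrite -xy.
apply: le_trans (dtheta_shift_le _) _; first by rewrite !letter0_prepend.
by rewrite !shift_prepend.
Qed.

(** Points at distance less than 1 share their first letter, hence [prepend i]
    is locally a contraction or the identity. *)
Lemma measurable_prepend i :
  measurable_fun [set: Borel X] (prepend i : Borel X -> Borel X).
Proof.
apply: (@measurability _ _ (Borel X) (Borel X) setT (prepend i) open) => //.
move=> _ [U oU <-]; rewrite setTI; apply: sub_sigma_algebra; move: oU.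
rewrite !openE => oU x /oU; rewrite /interior -!nbhs_ballE => -[e /= e0 eU].
exists (Num.min 1 e); first by rewrite /= lt_min ltr01.
move=> y; rewrite ballEmdist/= lt_min => /andP[/dtheta_lt1 xy0 xye]; apply: eU.
rewrite ballEmdist/=; apply: le_lt_trans xye; rewrite !mdist_subshiftE.
have [Aix|Aix] := pselect (A i (letter x 0) = 1%N).
  apply: le_trans (dtheta_prepend xy0 Aix) _.
  by rewrite ler_piMl// (mdist_ge0 x y).
rewrite /prepend; case: pselect => // _; case: pselect => // Aiy.
by case: Aix; rewrite xy0.
Qed.

Lemma measurable_letter0 (c : I -> R) :
  measurable_fun [set: Borel X] (fun x : Borel X => c (letter (x : X) 0)).
Proof.
have -> : (fun x : Borel X => c (letter (x : X) 0)) =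
    (fun x : Borel X => \sum_b c b * \1_(cylinder [:: b] : set (Borel X)) x).
  apply/funext => x; rewrite (bigD1 (letter (x : X) 0))//= big1 ?addr0.
    rewrite indicE mem_set ?mulr1//.
  move=> b xb; rewrite indicE memNset ?mulr0// => -[] /eqP.
  by rewrite eq_sym (negbTE xb).
apply: measurable_sum => b; apply: measurable_funM => //.
by apply: measurable_indic; exact: measurable_cylinder.
Qed.

Definition back (x : Borel X) : set (Borel X) -> \bar R :=
  msum (fun k => mscale (NngNum (weight_ge0 (inord k) (letter (x : X) 0)))
                        (dirac (prepend (inord k) x : Borel X))) N.+1.

HB.instance Definition _ x := Measure.on (back x).

Lemma backE x B : back x B =
  (\sum_i (weight i (letter (x : X) 0))%:E *
           (\1_B (prepend i x : Borel X))%:E)%E.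
Proof.
rewrite /back /msum; apply: eq_bigr => i _.
by rewrite inord_val; exact: erefl.
Qed.

Let back_setT x : (back x setT <= 1)%E.
Proof.
rewrite backE; under eq_bigr do rewrite indicT mule1.
by rewrite sumEFin sum_weight.
Qed.

HB.instance Definition _ x :=
  Measure_isSubProbability.Build _ _ _ (back x) (@back_setT x).

Lemma integral_back x (f : Borel X -> \bar R) :
  measurable_fun setT f -> (forall y, 0 <= f y)%E ->
  (\int[back x]_y f y =
    \sum_i (weight i (letter (x : X) 0))%:E * f (prepend i x))%E.
Proof.
move=> mf f0; rewrite /back ge0_integral_measure_sum//.
apply: eq_bigr => i _; rewrite inord_val ge0_integral_mscale//.
by rewrite integral_dirac// diracT mul1e.
Qed.

Definition backward (x : Borel X) : giry (Borel X) R := back x.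

Lemma measurable_backward : measurable_fun setT backward.
Proof.
apply: measurable_giry_codensity => // B mB.
under eq_fun do rewrite [backward _ _]backE.
apply: emeasurable_sum => i; apply: emeasurable_funM.
  apply/(@measurable_EFinP _ (Borel X) _ _
    (fun x : Borel X => weight i (letter (x : X) 0))).
  exact: measurable_letter0.
apply/(@measurable_EFinP _ (Borel X) _ _ (\1_B \o prepend i)).
apply: measurableT_comp; first exact: measurable_indic.
exact: measurable_prepend.
Qed.

End markov.

(** * Invariance of the Markov measure and the transfer operator *)

Section transfer.
Context {R : realType} {N : nat} {A : aperiodic_matrix N}.
Context {theta : {itv R & `]0%Z, 1%Z[}}.
Local Notation X := (subshift A theta).
Local Notation I := 'I_N.+1.
Variables (m : probability (Borel X) R) (p : 'M[R]_N.+1) (q : 'rV[R]_N.+1).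
Hypotheses (hp : stochastic_for (A := A) p) (hq : stationary p q).
Hypothesis hm : forall (n : nat) (a : nat -> I),
  m [set x : X | forall i, (i <= n)%N -> letter x i = a i] =
  (q 0 (a 0%N) * \prod_(i < n) p (a i) (a i.+1))%:E.
Local Notation W := (@backward R N A theta p q hp hq).
Local Notation mW := (@measurable_backward R N A theta p q hp hq).
Local Notation weight := (weight p q).
Local Notation T := (shift : Borel X -> Borel X).

Let back_cylinder x a s : W x (cylinder (a :: s)) =
  ((weight a (letter (x : X) 0))%:E * (\1_(cylinder s : set (Borel X)) x)%:E)%E.
Proof.
rewrite [LHS]backE (bigD1 a)//= big1 ?adde0 => [|i ia].
- have [Aax|Aax] := pselect (A a (letter (x : X) 0) = 1%N); last first.
    by rewrite (weight0 q hp Aax) !mul0e.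
  congr (_ * _%:E)%E; rewrite !indicE; congr (_%:R); congr nat_of_bool.
  apply/idP/idP; rewrite !inE.
    by move/cylinder_cons => [_]; rewrite shift_prepend.
  by move=> xs; apply/cylinder_cons; rewrite shift_prepend// letter0_prepend.
- have [Aix|Aix] := pselect (A i (letter (x : X) 0) = 1%N); last first.
    by rewrite (weight0 q hp Aix) !mul0e.
  rewrite indicE memNset ?mule0// => /cylinder_cons[].
  by rewrite letter0_prepend// => /eqP; rewrite (negbTE ia).
Qed.

Lemma backward_setT x : W x setT = 1%E.
Proof.
rewrite [LHS]backE; under eq_bigr do rewrite indicT mule1.
by rewrite sumEFin (sum_weight hp hq).
Qed.

Let backward_invariant_cylinder s :
  m (cylinder s) = (\int[m]_x W x (cylinder s))%E.
Proof.
case: s => [|a s].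
  rewrite cylinder_nil.
  under eq_integral do rewrite backward_setT.
  by rewrite integral_cst// mul1e.
under eq_integral do rewrite back_cylinder.
case: s => [|b s].
  under eq_integral.
    move=> x _; rewrite cylinder_nil.
    rewrite indicT mule1.
    have -> : (weight a (letter (x : X) 0))%:E = (\sum_b (weight a b)%:E *
        (\1_(cylinder [:: b] : set (Borel X)) x)%:E)%E.
      rewrite (bigD1 (letter (x : X) 0))//= big1 ?adde0 => [|b xb].
        by rewrite indicE mem_set// mule1.
      rewrite indicE memNset ?mule0// => /cylinder_cons[/eqP].
      by rewrite eq_sym (negbTE xb).
    over.
  rewrite ge0_integral_sum//; last 2 first.
  - move=> b; apply: measurable_funeM; apply: measurable_EFin_indic.
    exact: measurable_cylinder.
  - by move=> b x _; rewrite mule_ge0// lee_fin// (weight_ge0 hp hq).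
  rewrite (eq_bigr (fun b => (q 0 a * p a b)%:E)) => [|b _].
    rewrite sumEFin -mulr_sumr; case: hp => _ -> _.
    by rewrite mulr1 (markov_cylinder1 hm).
  rewrite ge0_integralZl//.
  - rewrite integral_indic//; last exact: measurable_cylinder.
    transitivity ((weight a b)%:E * (q 0 b)%:E)%E.
      by congr (_ * _)%E; rewrite setIT; exact: (markov_cylinder1 hm).
    by rewrite -EFinM /weight divfK ?gt_eqF ?(stationary_gt0 hp hq).
  - by apply: measurable_EFin_indic; exact: measurable_cylinder.
  - by rewrite lee_fin (weight_ge0 hp hq).
rewrite (markov_cylinder2 hp hq hm).
under eq_integral => x _.
  have -> : ((weight a (letter (x : X) 0))%:E *
      (\1_(cylinder (b :: s) : set (Borel X)) x)%:E =
    (weight a b)%:E * (\1_(cylinder (b :: s) : set (Borel X)) x)%:E)%E.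
    have [/set_mem/cylinder_cons[-> _]//|xbs] :=
      boolP (x \in cylinder (b :: s)).
    by rewrite indicE (negbTE xbs) !mule0.
  over.
have mc : measurable (cylinder (b :: s) : set (Borel X)).
  exact: measurable_cylinder.
rewrite ge0_integralZl//.
- by rewrite integral_indic// setIT.
- exact: measurable_EFin_indic.
- by rewrite lee_fin (weight_ge0 hp hq).
Qed.

(** It suffices to compare both sides on cylinders, where prepending [a] to a
    word that starts with [b] multiplies the mass by [weight a b]. *)
Lemma backward_invariant B : measurable B -> m B = (\int[m]_x W x B)%E.
Proof.
move=> mB; rewrite -[RHS](giry_bindE (m : giry _ _) mW mB); move: B mB.
apply: measure_unique_cylinders.
  by apply: le_lt_trans (sprobability_setT (s := m)) _; rewrite ltry.
move=> s; rewrite [RHS]giry_bindE; last exact: measurable_cylinder.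
exact: backward_invariant_cylinder.
Qed.

Lemma integral_backward (f : Borel X -> \bar R) :
  measurable_fun setT f -> (forall x, 0 <= f x)%E ->
  (\int[m]_x f x = \int[m]_x \int[W x]_y f y)%E.
Proof.
move=> mf f0; rewrite (@integral_mixture _ _ _ _ _ m m W mW)//.
exact: backward_invariant.
Qed.

(** The backward kernel from [x] is carried by the preimages of [x]. *)
Lemma integral_backward_shift x (f : Borel X -> Borel X -> \bar R) :
  measurable_fun setT (f x) -> (forall y, 0 <= f x y)%E ->
  measurable_fun setT (fun y : Borel X => f (T y) y) ->
  (forall y, 0 <= f (T y) y)%E ->
  (\int[W x]_y f x y = \int[W x]_y f (T y) y)%E.
Proof.
move=> mf f0 mg g0; rewrite [LHS]integral_back// [RHS]integral_back//.
apply: eq_bigr => i _.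
have [Aix|Aix] := pselect (A i (letter (x : X) 0) = 1%N); last first.
  by rewrite (weight0 q hp Aix) !mul0e.
by rewrite shift_prepend.
Qed.

Lemma shift_invariant B : measurable B -> m (T @^-1` B) = m B.
Proof.
move=> mB.
have mI : measurable_fun setT (EFin \o \1_B : Borel X -> \bar R).
  exact: measurable_EFin_indic.
have mIs : measurable_fun setT (EFin \o \1_B \o T : Borel X -> \bar R).
  exact: (measurableT_comp mI measurable_shift).
have mSB : measurable (T @^-1` B : set (Borel X)).
  by rewrite -[X in measurable X]setTI; exact: measurable_shift.
rewrite -(setIT (_ @^-1` _)) -integral_indic//.
rewrite integral_backward; last 2 first.
- by exact: measurable_EFin_indic.
- by move=> x; rewrite lee_fin.
rewrite -[in RHS](setIT B) -[RHS]integral_indic//; apply: eq_integral => x _.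
rewrite -[LHS](integral_backward_shift (f := fun z _ => (\1_B z)%:E))//.
rewrite integral_cst// -[RHS]mule1; congr (_ * _)%E; exact: backward_setT.
Qed.

(** The Perron-Frobenius operator of the shift for [m]. *)
Definition transfer (phi : X -> R) (x : X) : R :=
  \sum_i weight i (letter x 0) * phi (prepend i x).

Lemma transfer_le (phi : X -> R) (M : R) :
  (forall x, `|phi x| <= M) -> forall x, `|transfer phi x| <= M.
Proof.
move=> phiM x; rewrite /transfer (le_trans (ler_norm_sum _ _ _))//.
rewrite -[leRHS]mul1r -(sum_weight hp hq (letter x 0)) mulr_suml.
apply: ler_sum => i _; rewrite normrM ger0_norm ?(weight_ge0 hp hq)//.
by rewrite ler_wpM2l ?(weight_ge0 hp hq).
Qed.

(** [transfer phi] is the density of the image under the shift of the measure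
    with density [phi].  The bound [M] makes [phi + M] nonnegative, which
    reduces the claim to integrals of nonnegative functions. *)
Lemma integral_transfer (phi : Borel X -> R) (M : R) B :
  measurable_fun setT phi -> (forall x, `|phi x| <= M) -> measurable B ->
  (\int[m]_(x in T @^-1` B) (phi x)%:E =
   \int[m]_(x in B) (transfer phi x)%:E)%E.
Proof.
move=> mphi phiM mB.
have mSB : measurable (T @^-1` B : set (Borel X)).
  by rewrite -[X in measurable X]setTI; exact: measurable_shift.
have transferM := transfer_le phiM.
have mtransfer : measurable_fun setT (transfer phi : Borel X -> R).
  apply: measurable_sum => i; apply: measurable_funM.
    exact: (measurable_letter0 (weight i)).
  exact: (measurableT_comp mphi (measurable_prepend i)).
have iM : m.-integrable setT (EFin \o cst M : Borel X -> \bar R).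
  by apply: (bounded_integrable m measurableT (M := `|M|)).
have i1 D : measurable D -> m.-integrable D (EFin \o phi).
  by move=> mD; exact: (bounded_integrable m mD mphi phiM).
have i2 D : measurable D -> m.-integrable D (EFin \o transfer phi).
  by move=> mD; exact: (bounded_integrable m mD mtransfer transferM).
have pM x : 0 <= phi x + M.
  by rewrite -lerBlDr sub0r; move: (phiM x); rewrite ler_norml => /andP[].
pose g (z y : Borel X) : \bar R := ((phi y + M)%:E * (\1_B z)%:E)%E.
have mphiM : measurable_fun setT (fun y : Borel X => (phi y + M)%:E).
  by apply/measurable_EFinP; exact: measurable_funD.
have g0 z y : (0 <= g z y)%E by rewrite mule_ge0// lee_fin.
have mg z : measurable_fun setT (g z) by apply: emeasurable_funM.
have mgs : measurable_fun setT (fun y : Borel X => g (T y) y).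
  apply: emeasurable_funM => //.
  exact: (measurableT_comp (measurable_EFin_indic mB) measurable_shift).
have key : (\int[m]_(x in T @^-1` B) (phi x + M)%:E =
    \int[m]_(x in B) (transfer phi x + M)%:E)%E.
  rewrite integral_mkcond epatch_indic -[LHS]/(\int[m]_y g (T y) y)%E.
  rewrite integral_backward// [RHS]integral_mkcond epatch_indic.
  apply: eq_integral => x _.
  rewrite -(integral_backward_shift (f := g))//.
  rewrite [LHS](integral_back hp hq _ (mg x) (g0 x)).
  rewrite /g /=.
  under eq_bigr do rewrite -!EFinM mulrA mulrDr.
  rewrite sumEFin -mulr_suml big_split/= -mulr_suml.
  by rewrite (sum_weight hp hq) mul1r.
move: key; rewrite !integralD_EFin//; try exact: i1; try exact: i2;
  try exact: integrableS iM.
rewrite !integral_cst// => h.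
have fin : (M%:E * m B)%E \is a fin_num by rewrite fin_numM// fin_num_measure.
rewrite -[LHS](addeK _ fin) -[RHS](addeK _ fin); congr (_ - _)%E.
by rewrite -{1}(shift_invariant mB); exact: h.
Qed.

(** If [x] and [y] share their first letter, the weights are equal and the
    preimages are closer by a factor [theta]; otherwise [dtheta x y >= 1] and
    the bound [2 * s] on the difference is enough. *)
Lemma transfer_lipschitz (phi : X -> R) (c s : R) : 0 <= c -> 0 <= s ->
  lipschitz_with c phi -> (forall x, `|phi x| <= s) ->
  lipschitz_with (theta%:num * c + 2 * s) (transfer phi).
Proof.
move=> c0 s0 cphi phis x y; rewrite mdist_subshiftE.
have transfers := transfer_le phis.
have d0 : 0 <= dtheta x y := mdist_ge0 x y.
have [xy|xy] := eqVneq (letter x 0) (letter y 0); last first.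
  have d1 : 1 <= dtheta x y by have := dtheta_ge xy; rewrite expr0.
  apply: (@le_trans _ _ (2 * s)).
    by rewrite (le_trans (ler_normB _ _))// mulr_natl mulr2n lerD.
  rewrite [leRHS]mulrDl; apply: (@le_trans _ _ (2 * s * dtheta x y)).
    by apply: ler_peMr => //; rewrite mulr_ge0.
  by rewrite lerDr !mulr_ge0.
apply: (@le_trans _ _ (theta%:num * c * dtheta x y)); last first.
  by rewrite ler_wpM2r// lerDl mulr_ge0.
rewrite /transfer xy -sumrB (le_trans (ler_norm_sum _ _ _))//.
rewrite -[leRHS]mul1r -(sum_weight hp hq (letter y 0)) mulr_suml.
apply: ler_sum => i _; rewrite -mulrBr normrM ger0_norm ?(weight_ge0 hp hq)//.
have [Aiy|Aiy] := pselect (A i (letter y 0) = 1%N); last first.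
  by rewrite (weight0 q hp Aiy) !mul0r.
rewrite ler_wpM2l ?(weight_ge0 hp hq)// (le_trans (cphi _ _))//.
rewrite -mulrA [leRHS]mulrCA; apply: ler_wpM2l => //.
by rewrite mdist_subshiftE; apply: dtheta_prepend; rewrite ?xy.
Qed.

End transfer.

(** * Test functions on the fibre *)

Section unit_tests.
Context {R : realType} {K : pmetricType R}.

Definition unit_test (g : K -> R) :=
  lipschitz_with 1 g /\ forall y, `|g y| <= 1.

Lemma unit_test_cst (a : R) : `|a| <= 1 -> unit_test (cst a).
Proof.
by move=> a1; split => // x y; rewrite subrr normr0 mul1r mdist_ge0.
Qed.

Lemma compact_net (e : R) : compact [set: K] -> 0 < e ->
  exists s : seq K, forall y, exists2 z, z \in s & mdist z y < e.
Proof.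
rewrite compact_cover => cK e0.
have [|z _|D _ DK] := cK K setT (fun z => (ball z e)^°).
- by move=> z _; exact: open_interior.
- by exists z => //; exact: nbhsx_ballx.
exists (enum_fset D) => y; have [//|z /= zD yz] := DK y.
by exists z => //; have := interior_subset yz; rewrite ballEmdist.
Qed.

(** A test is determined up to [4 / k.+1] by its values, rounded down to
    multiples of [1 / k.+1], on a [1 / k.+1]-net.  There are countably many
    lists of such values, and [G] chooses one test for each list that occurs. *)
Lemma unit_test_separable : compact [set: K] ->
  exists G : nat -> K -> R, (forall n, unit_test (G n)) /\
    forall g e, unit_test g -> 0 < e -> exists n, forall y, `|g y - G n y| <= e.
Proof.
move=> cK.
have k0 k : 0 < k.+1%:R^-1 :> R by rewrite invr_gt0 ltr0n.
have /choice[net netP] k := compact_net cK (k0 k).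
pose close k (s : seq int) (g : K -> R) := forall z, z \in net k ->
  `|g z - (nth 0 s (index z (net k)))%:~R / k.+1%:R| <= k.+1%:R^-1.
have pick (i : nat * seq int) : exists g, unit_test g /\
    ((exists g', unit_test g' /\ close i.1 i.2 g') -> close i.1 i.2 g).
  have [[g [ug cg]]|no] :=
    pselect (exists g', unit_test g' /\ close i.1 i.2 g').
    by exists g.
  by exists (cst 0); split => //; apply: unit_test_cst; rewrite normr0 ler01.
have [G GP] := choice pick.
pose code (n : nat) : nat * seq int := odflt (0%N, [::]) (choice.unpickle n).
exists (G \o code); split=> [n|g e ug e0]; first exact: (GP _).1.
pose k := Num.truncn (4 / e).
have ke : 4 / k.+1%:R <= e.
  rewrite ler_pdivrMr ?ltr0n// mulrC -ler_pdivrMr//.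
  by rewrite ltW// truncnS_gt.
pose s := [seq Num.floor (g z * k.+1%:R) | z <- net k].
have cg : close k s g.
  move=> z zk; rewrite (nth_map z) ?index_mem// nth_index//.
  have := floor_itv (g z * k.+1%:R) => /andP[fl fr].
  rewrite intrD in fr; move: (Num.floor _)%:~R fl fr => f fl fr.
  have kp : 0 < k.+1%:R :> R by rewrite ltr0n.
  rewrite -(ler_pM2r kp) mulVf ?gt_eqF// -[X in _ * X](gtr0_norm kp) -normrM.
  rewrite mulrBl divfK ?gt_eqF// ger0_norm ?subr_ge0//.
  by rewrite lerBlDl ltW.
have cG : close k s (G (k, s)) by apply: (GP (k, s)).2; exists g.
exists (choice.pickle (k, s)) => y /=; rewrite /code choice.pickleK/=.
have [z zk] := netP k y; rewrite metric_sym => yz.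
have [[gl _] [Gl _]] := (ug, (GP (k, s)).1).
have g1 := gl y z; have G1 := Gl y z; rewrite !mul1r in g1 G1.
have g2 := cg _ zk; have G2 := cG _ zk.
apply: le_trans ke.
move: (k.+1%:R^-1) yz g2 G2 => d yz g2 G2.
move: (_%:~R * d) g2 G2 => a.
move: g1 G1; rewrite !ler_norml => /andP[g4 g5] /andP[G4 G5].
move=> /andP[g2 g3] /andP[G2 G3].
by apply/andP; split; lra.
Qed.

End unit_tests.

(** * Duality for the norm of the fibre measures *)

Section ae_bound.
Context d (T : measurableType d) (R : realType).
Variables (m : {finite_measure set T -> \bar R}) (h : T -> \bar R) (c : R).
Hypothesis ih : m.-integrable setT h.

(** On the set [E] where [h > c] the function [h - c] is positive and has
    integral at most 0, so [E] is negligible. *)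
Lemma ae_le_of_integral_le :
  (forall E, measurable E -> (\int[m]_(x in E) h x <= c%:E * m E)%E) ->
  {ae m, forall x, (h x <= c%:E)%E}.
Proof.
move=> hE; have mh := measurable_int _ ih.
pose E := [set x | (c%:E < h x)%E].
have mE : measurable E.
  by rewrite /E -[X in measurable X]setTI; exact: emeasurable_fun_o_infty.
have ihE : m.-integrable E h by exact: integrableS ih.
have icE : m.-integrable E (cst c%:E).
  by apply: finite_measure_integrable_cst.
have ihc : m.-integrable E (fun x => h x - c%:E)%E by exact: integrableB.
have int0 : (\int[m]_(x in E) `|h x - c%:E| = 0)%E.
  rewrite (eq_integral (fun x => h x - c%:E)%E); last first.
    by move=> x /set_mem Ex; rewrite gee0_abs// sube_ge0// ltW.
  apply/eqP; rewrite eq_le; apply/andP; split; last first.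
    by apply: integral_ge0 => x Ex; rewrite sube_ge0// ltW.
  rewrite integralB// integral_cst// sube_le0; exact: hE.
have : ae_eq m E (fun x => h x - c%:E)%E (cst 0%E).
  apply/ae_eq_integral_abs => //; exact: measurable_int ihc.
apply: filterS => x Ex; rewrite leNgt; apply/negP => chx.
by have /= hc := Ex chx; move: chx; rewrite -sube_gt0 hc ltxx.
Qed.

End ae_bound.

Lemma ae_abs_le_of_integral_le d (T : measurableType d) (R : realType)
    (m : {finite_measure set T -> \bar R}) (h : T -> \bar R) (c : R) :
  m.-integrable setT h ->
  (forall E, measurable E -> (`|\int[m]_(x in E) h x| <= c%:E * m E)%E) ->
  {ae m, forall x, (`|h x| <= c%:E)%E}.
Proof.
move=> ih hE.
have h1 : {ae m, forall x, (h x <= c%:E)%E}.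
  apply: ae_le_of_integral_le => // E mE.
  exact: le_trans (lee_abs _) (hE _ mE).
have h2 : {ae m, forall x, (- h x <= c%:E)%E}.
  apply: ae_le_of_integral_le => [|E mE]; first exact: integrableN.
  have ihE : m.-integrable E h := integrableS measurableT mE (@subsetT _ _) ih.
  rewrite integralN; last exact: integrable_add_def.
  by apply: le_trans (hE _ mE); rewrite -[leRHS]abseN; exact: lee_abs.
apply: filterS2 h1 h2 => x hx1 hx2.
have [h0|h0] := leP 0%E (h x); first by rewrite gee0_abs.
by rewrite lte0_abs.
Qed.

Lemma integral_mscale d (T : measurableType d) (R : realType)
    (nu : {finite_measure set T -> \bar R}) (r : {nonneg R}) (F : T -> R) M :
  measurable_fun setT F -> (forall z, `|F z| <= M) ->
  (\int[mscale r nu]_z (F z)%:E = r%:num%:E * \int[nu]_z (F z)%:E)%E.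
Proof.
move=> mF FM; have iF := bounded_integrable nu measurableT mF FM.
have mF' : measurable_fun setT (EFin \o F) by exact/measurable_EFinP.
rewrite [LHS]integralE [in RHS]integralE muleBr//; last first.
  apply: fin_num_adde_defr; apply: integrable_fin_num => //.
  exact: integrable_funepos.
rewrite !ge0_integral_mscale//.
- exact: measurable_funeneg.
- exact: measurable_funepos.
Qed.

Section dual.
Context {R : realType} {N : nat} {A : aperiodic_matrix N}.
Context {theta : {itv R & `]0%Z, 1%Z[}} {K : pmetricType R}.
Local Notation X := (subshift A theta).
Local Notation XK := (Borel X * Borel K)%type.
Variable m : probability (Borel X) R.
Variable mu : {charge set XK -> \bar R}.
Variables kp kn : Borel X -> probability XK R.
Hypotheses (ABmu : AB m mu).
Hypotheses (dp : disintegration m (jpos mu) kp)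
  (dn : disintegration m (jneg mu) kn).

Let domp := ABmu.1.
Let domn := ABmu.2.
Local Notation rp := (marginal_density m (jpos mu)).
Local Notation rn := (marginal_density m (jneg mu)).
Local Notation ep := (fiber_law kp).
Local Notation en := (fiber_law kn).

Definition fiber_charge (x : Borel X) : {charge set (Borel K) -> \bar R} :=
  cadd (restriction m (jpos mu) kp x) (copp (restriction m (jneg mu) kn x)).

(** A version of the integral against [fiber_charge x] that is measurable in
    [x] and free of Jordan decompositions, hence additive for the two parts of
    [mu].  The two integrals agree for almost every [x]. *)
Definition fiber_integral (x : Borel X) (g : K -> R) : \bar R :=
  ((\int[ep x]_y (g y)%:E) * rp x - (\int[en x]_y (g y)%:E) * rn x)%E.

(** The exceptional set, where the nonnegative version of a density differs from
    the given one, does not depend on [g]: the supremum over all tests can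
    be taken outside of it. *)
Lemma fiber_chargeE : {ae m, forall x, forall (g : Borel K -> R) M,
  measurable_fun setT g -> (forall y, `|g y| <= M) ->
  charge_integral (fiber_charge x) g = fiber_integral x g}.
Proof.
have := marginal_densityE domp; have := marginal_densityE domn.
apply: filterS2 => x /(_ I) xn /(_ I) xp g M mg gM.
have p0 : 0 <= fine (rp x) by rewrite fine_ge0// marginal_density_ge0.
have n0 : 0 <= fine (rn x) by rewrite fine_ge0// marginal_density_ge0.
rewrite (@charge_integralE _ _ _ _ (mscale (NngNum p0) (ep x))
  (mscale (NngNum n0) (en x)) _ M)//; last first.
  move=> E mE; rewrite /fiber_charge /cadd/= /copp /restriction /cscale/=.
  by rewrite xn xp.
rewrite !(integral_mscale _ _ mg gM)/= !fineK ?marginal_density_fin//.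
by rewrite /fiber_integral ![(_ * \int[_]_z _)%E]muleC.
Qed.

Lemma charge_integral_fiber (F : XK -> R) (M : R) :
  measurable_fun setT F -> (forall z, `|F z| <= M) ->
  m.-integrable setT (fun x => fiber_integral x (fun y => F (x, y))) /\
  charge_integral mu F = (\int[m]_x fiber_integral x (fun y => F (x, y)))%E.
Proof.
move=> mF FM.
have ip := integrable_disintegration dp domp mF FM.
have i_n := integrable_disintegration dn domn mF FM.
split; first exact: integrableB.
rewrite /charge_integral (integral_disintegration dp domp mF FM).
by rewrite (integral_disintegration dn domn mF FM) integralB.
Qed.

Lemma charge_integral_fiber_on (F : XK -> R) (M : R) E :
  measurable_fun setT F -> (forall z, `|F z| <= M) -> measurable E ->
  charge_integral mu (fun z => F z * \1_E z.1) =
    (\int[m]_(x in E) fiber_integral x (fun y => F (x, y)))%E.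
Proof.
move=> mF FM mE.
have M0 : 0 <= M by apply: le_trans (FM point).
have mF' : measurable_fun setT (fun z : XK => F z * \1_E z.1).
  by apply: measurable_funM => //; exact: measurableT_comp.
have FM' z : `|F z * \1_E z.1| <= M.
  rewrite normrM indicE.
  by case: (_ \in _); rewrite ?normr1 ?normr0 ?mulr1 ?mulr0.
rewrite (charge_integral_fiber mF' FM').2.
rewrite [RHS]integral_mkcond; apply: eq_integral => x _; rewrite patchE.
case: ifPn => xE.
  by congr fiber_integral; apply/funext => y /=; rewrite indicE xE mulr1.
have -> : (fun y => F (x, y) * \1_E (x, y).1) = cst 0.
  by apply/funext => y /=; rewrite indicE (negbTE xE) mulr0.
by rewrite /fiber_integral !integral0 !mul0e sube0.
Qed.

(** From the norm to the dual bound: the integral against [mu] is the integral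
    over [E] of the fibre integrals, each bounded by [c].  The function [F] may
    vary with the fibre so that the lemma applies to [g \o G]. *)
Lemma fiber_bound_dual (c : R) (F : XK -> R) E : 0 <= c ->
  {ae m, forall x, (wnorm (fiber_charge x) <= c%:E)%E} ->
  measurable_fun setT F -> (forall z, `|F z| <= 1) ->
  {ae m, forall x, lipschitz_with 1 (fun y : K => F (x, y))} ->
  measurable E ->
  (`|charge_integral mu (fun z => F z * \1_E z.1)%R| <= c%:E * m E)%E.
Proof.
move=> c0 wc mF FM lF mE.
rewrite (charge_integral_fiber_on mF FM mE).
have [iF _] := charge_integral_fiber mF FM.
have mi : measurable_fun E (fun x => fiber_integral x (fun y => F (x, y))).
  by apply: measurable_funTS; exact: (measurable_int _ iF).
apply: le_trans (le_abse_integral _ mE mi) _.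
apply: integral_le_bound => //.
apply: filterS3 fiber_chargeE wc lF => x xE xc xl _.
have mFx : measurable_fun setT (fun y : Borel K => F (x, y)).
  exact: measurableT_comp (pair1_measurable x).
rewrite -(xE _ 1)//; apply: le_trans xc.
by apply: ereal_sup_ubound; exists (fun y => F (x, y)).
Qed.

(** Lets a bound pass from a dense sequence of tests to all of them. *)
Lemma fiber_integral_close x (g g' : Borel K -> R) (e : R) :
  measurable_fun setT g -> measurable_fun setT g' ->
  (forall y, `|g y| <= 1) -> (forall y, `|g' y| <= 1) -> 0 <= e ->
  (forall y, `|g y - g' y| <= e) ->
  (`|fiber_integral x g - fiber_integral x g'| <= e%:E * (rp x + rn x))%E.
Proof.
move=> mg mg' g1 g'1 e0 gg'.
have close (eta : giry (Borel K) R) :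
    (`|\int[eta]_y (g y)%:E - \int[eta]_y (g' y)%:E| <= e%:E)%E.
  have ig := bounded_integrable eta measurableT mg g1.
  have ig' := bounded_integrable eta measurableT mg' g'1.
  rewrite -integralB_EFin//.
  apply: le_trans (le_abse_integral _ measurableT _) _.
    by apply/measurable_EFinP; exact: measurable_funB.
  apply: (@le_trans _ _ (e%:E * eta setT)%E).
    apply: integral_le_bound => //.
      by apply/measurable_EFinP; exact: measurable_funB.
    by apply: aeW => y _ /=; rewrite lee_fin.
  by rewrite -[leRHS]mule1 lee_wpmul2l// sprobability_setT.
have fin (eta : giry (Borel K) R) (h : Borel K -> R) : measurable_fun setT h ->
    (forall y, `|h y| <= 1) -> (\int[eta]_y (h y)%:E)%E \is a fin_num.
  move=> mh h1; apply: integrable_fin_num => //.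
  exact: (bounded_integrable eta _ mh h1).
have := close (ep x); have := close (en x); rewrite /fiber_integral.
have := fin (ep x) _ mg g1; have := fin (en x) _ mg g1.
have := fin (ep x) _ mg' g'1; have := fin (en x) _ mg' g'1.
move: (\int[ep x]_y (g y)%:E)%E (\int[en x]_y (g y)%:E)%E.
move: (\int[ep x]_y (g' y)%:E)%E (\int[en x]_y (g' y)%:E)%E.
have := marginal_density_fin domp x; have := marginal_density_fin domn x.
have := marginal_density_ge0 domp x; have := marginal_density_ge0 domn x.
move: (rp x) (rn x) => [a| |] [b| |]// b0 a0 _ _.
move=> [s| |]// [s'| |]// [t| |]// [t'| |]//.
rewrite !lee_fin in a0 b0 *; move=> _ _ _ _.
move=> h1 h2.
have -> : t * a - t' * b - (s * a - s' * b) =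
  (t - s) * a - (t' - s') * b by ring.
apply: le_trans (ler_normB _ _) _; rewrite !normrM mulrDr.
rewrite (ger0_norm a0) (ger0_norm b0).
by apply: lerD; rewrite ler_wpM2r.
Qed.

(** For a single [g] the dual bound holds for all [E] and hence bounds the fibre
    integral of [g] almost everywhere.  Only the separability of the tests gives
    one null set for all [g], that is a bound on the norm. *)
Lemma dual_bound_fiber (c : R) : compact [set: K] ->
  (forall (g : K -> R) E, unit_test g -> measurable E ->
    (`|charge_integral mu (fun z => g z.2 * \1_E z.1)%R| <= c%:E * m E)%E) ->
  {ae m, forall x, (wnorm (fiber_charge x) <= c%:E)%E}.
Proof.
move=> cK dual; have [G [uG Gdense]] := unit_test_separable cK.
have munit g : unit_test g -> measurable_fun setT (g : Borel K -> R).
  by move=> [/lipschitz_Borel_measurable].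
have : {ae m, forall x, forall n, (`|fiber_integral x (G n)| <= c%:E)%E}.
  apply: ae_foralln => n; have [_ Gn1] := uG n.
  have mF : measurable_fun setT (fun z : XK => G n z.2).
    exact: measurableT_comp (munit _ (uG n)) _.
  have FM (z : XK) : `|G n z.2| <= 1 by exact: Gn1.
  apply: ae_abs_le_of_integral_le.
    exact: (charge_integral_fiber mF FM).1.
  move=> E mE; rewrite -(charge_integral_fiber_on mF FM mE); exact: dual.
apply: filterS2 fiber_chargeE => x xE xG.
apply: ge_ereal_sup => _ [g ug <-].
have mg := munit _ ug; have g1 := ug.2.
rewrite (xE g 1 mg g1); apply/lee_addgt0Pr => e e0.
have rfin : (rp x + rn x)%E \is a fin_num.
  by rewrite fin_numD !marginal_density_fin.
have r0 : (0 <= rp x + rn x)%E by rewrite adde_ge0// marginal_density_ge0.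
pose r := fine (rp x + rn x)%E.
have r0' : 0 <= r by exact: fine_ge0.
have d0 : 0 < e / (r + 1) by rewrite divr_gt0// ltr_wpDl.
have [n gn] := Gdense g _ ug d0.
have := fiber_integral_close x mg (munit _ (uG n)) g1 (uG n).2 (ltW d0) gn.
rewrite -(fineK rfin) -/r -EFinM => close.
have small : e / (r + 1) * r <= e.
  rewrite -mulrA ler_piMr ?(ltW e0)// mulrC ler_pdivrMr ?ltr_wpDl//.
  by rewrite mul1r lerDl.
have fing (h : Borel K -> R) :
    measurable_fun setT h -> (forall y, `|h y| <= 1) ->
    fiber_integral x h \is a fin_num.
  move=> mh h1; have ih (eta : giry (Borel K) R) :
      (\int[eta]_y (h y)%:E)%E \is a fin_num.
    apply: integrable_fin_num => //.
    exact: (bounded_integrable eta _ mh h1).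
  by rewrite /fiber_integral fin_numB !fin_numM// marginal_density_fin.
have := fing _ mg g1; have := fing _ (munit _ (uG n)) (uG n).2.
move: close (xG n).
move: (fiber_integral x (G n)) (fiber_integral x g) => [b| |]// [a| |]//.
rewrite -EFinB !abse_EFin -EFinD !lee_fin => h1 h2 _ _.
have -> : a = b + (a - b) by ring.
apply: le_trans (ler_normD _ _) _; apply: lerD => //.
exact: le_trans h1 small.
Qed.

End dual.

(** * Disintegration of images under the skew product *)

Section jordan_minimality.
Context d (T : measurableType d) (R : realType).
Variables (nu : {charge set T -> \bar R}).
Variables (nu1 nu2 : {finite_measure set T -> \bar R}).
Hypothesis nuE : forall E, measurable E -> nu E = (nu1 E - nu2 E)%E.

(** The Jordan decomposition is minimal: on its positive set, [nu] is at most
    [nu1]. *)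
Lemma jpos_le E : measurable E -> (jpos nu E <= nu1 E)%E.
Proof.
move=> mE; have [[mP _] _ _ _] := svalP (hahn nu).
rewrite -[leLHS]/(if E \in measurable
  then nu (E `&` (sval (hahn nu)).1) else 0%E).
rewrite mem_set//.
have mEP : measurable (E `&` (sval (hahn nu)).1) by exact: measurableI.
rewrite nuE//; apply: (@le_trans _ _ (nu1 (E `&` (sval (hahn nu)).1))).
  by rewrite leeBlDr ?fin_num_measure// leeDl.
by apply: le_measure; [exact/mem_set|exact/mem_set|exact: subIsetl].
Qed.

Lemma jneg_le E : measurable E -> (jneg nu E <= nu2 E)%E.
Proof.
move=> mE; have [_ [mN _] _ _] := svalP (hahn nu).
rewrite -[leLHS]/(cscale (-1) (crestr0 nu mN) E).
rewrite cscaleN1 /copp /= /crestr0 /crestr.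
rewrite mem_set//.
have mEN : measurable (E `&` (sval (hahn nu)).2) by exact: measurableI.
rewrite nuE// fin_num_oppeB ?fin_num_measure// addeC.
apply: (@le_trans _ _ (nu2 (E `&` (sval (hahn nu)).2))).
  by rewrite leeBlDr ?fin_num_measure// leeDl.
by apply: le_measure; [exact/mem_set|exact/mem_set|exact: subIsetl].
Qed.

End jordan_minimality.

Lemma jordan_difference d (T : measurableType d) (R : realType)
    (nu : {charge set T -> \bar R}) E : measurable E ->
  nu E = (jpos nu E - jneg nu E)%E.
Proof.
move=> mE; rewrite [LHS](jordan_decomp (svalP (hahn nu)) mE).
by rewrite /cadd/= cscaleN1.
Qed.

Section skew_disintegration.
Context {R : realType} {N : nat} {A : aperiodic_matrix N}.
Context {theta : {itv R & `]0%Z, 1%Z[}} {K : pmetricType R}.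
Local Notation X := (subshift A theta).
Local Notation XK := (Borel X * Borel K)%type.
Local Notation I := 'I_N.+1.
Local Notation T := (shift : Borel X -> Borel X).
Variables (m : probability (Borel X) R) (p : 'M[R]_N.+1) (q : 'rV[R]_N.+1).
Hypotheses (hp : stochastic_for (A := A) p) (hq : stationary p q).
Hypothesis hm : forall (n : nat) (a : nat -> I),
  m [set x : X | forall i, (i <= n)%N -> letter x i = a i] =
  (q 0 (a 0%N) * \prod_(i < n) p (a i) (a i.+1))%:E.
Local Notation W := (@backward R N A theta p q hp hq).
Local Notation mW := (@measurable_backward R N A theta p q hp hq).
Variables (G : XK -> Borel K) (mG : measurable_fun setT G).
Local Notation S := (Defs.skew G : XK -> XK).
Local Notation mS := (measurable_skew mG).
Local Notation mm := (m : giry (Borel X) R).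

Section kernel_image.
Variables (eta : Borel X -> giry (Borel K) R) (meta : measurable_fun setT eta).

Definition moved_law (x : Borel X) : giry (Borel K) R :=
  giry_map mG (along eta x).

Lemma measurable_moved_law : measurable_fun setT moved_law.
Proof.
exact: (measurableT_comp (measurable_giry_map mG) (measurable_along meta)).
Qed.

(** The fibre law of the image above [x]: choose a preimage of [x] by the
    backward kernel, then move the law of its fibre by [G]. *)
Definition skew_law (x : Borel X) : giry (Borel K) R :=
  giry_bind (W x) measurable_moved_law.

Lemma measurable_skew_law : measurable_fun setT skew_law.
Proof.
exact: (measurableT_comp (measurable_giry_bind measurable_moved_law) mW).
Qed.

(** The backward kernel weighs the preimages of [x] so that [m] is preserved;
    integrating over [x] and its preimages [x'] is thus integrating over [x'],
    with [x] the shift of [x']. *)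
Lemma semidirect_skew (E : set XK) : measurable E ->
  semidirect mm measurable_skew_law E = semidirect mm meta (S @^-1` E).
Proof.
move=> mE; have mSE : measurable (S @^-1` E).
  by rewrite -[X in measurable X]setTI; exact: mS.
have mI := measurable_EFin_indic (R := R) mE.
have mIS := measurable_EFin_indic (R := R) mSE.
rewrite -[in LHS](setIT E) -[in RHS](setIT (_ @^-1` _)).
rewrite -[LHS]integral_indic// -[RHS]integral_indic//.
rewrite [LHS]integral_semidirect// [RHS]integral_semidirect//.
pose f (x x' : Borel X) : \bar R := (\int[eta x']_y (\1_E (x, G (x', y)))%:E)%E.
have mxG x : measurable_fun setT (fun z : XK => (\1_E (x, G z))%:E : \bar R).
  exact: (measurableT_comp mI (measurableT_comp (pair1_measurable x) mG)).
have mf x : measurable_fun setT (f x).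
  exact: (measurable_integral_fiber meta (mxG x)).
have fE x : (\int[skew_law x]_y (\1_E (x, y))%:E = \int[W x]_x' f x x')%E.
  have mIx : measurable_fun setT (fun y : Borel K => (\1_E (x, y))%:E : \bar R).
    exact: (measurableT_comp mI (pair1_measurable x)).
  rewrite -[LHS]/(giry_int (skew_law x) _) giry_int_bind//.
  apply: eq_integral => x' _.
  transitivity (giry_int (along eta x') (fun z => (\1_E (x, G z))%:E)).
    by rewrite giry_int_map.
  by rewrite (giry_int_along _ _ (mxG x)).
under eq_integral do rewrite fE.
have mfT : measurable_fun setT (fun x' => f (T x') x').
  exact: (measurable_integral_fiber meta mIS).
have f0 x x' : (0 <= f x x')%E by exact: integral_ge0.
transitivity (\int[m]_x \int[W x]_x' f (T x') x')%E.
  by apply: eq_integral => x _; exact: integral_backward_shift.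
transitivity (\int[m]_x' f (T x') x')%E.
  exact/esym/(integral_backward hp hq hm mfT).
by apply: eq_integral => x' _; apply: eq_integral.
Qed.

End kernel_image.

Variable mu : {charge set XK -> \bar R}.

Lemma Fstar_difference (E : set XK) : measurable E ->
  Fstar mG mu E = (mpush (jpos mu) mS E - mpush (jneg mu) mS E)%E.
Proof.
move=> mE; rewrite -[LHS]/(mu (S @^-1` E)) jordan_difference//.
by rewrite -[X in measurable X]setTI; exact: mS.
Qed.

(** The marginals of the Jordan parts of [F_* mu] are dominated by the images
    under the shift of those of [mu], and preimages of null sets under the
    shift are null. *)
Lemma AB_Fstar : AB m mu -> AB m (Fstar mG mu).
Proof.
have aux (nu nu' : {finite_measure set XK -> \bar R}) :
    (forall E, measurable E -> (nu' E <= mpush nu mS E)%E) ->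
    mpush nu (@measurable_fst _ _ _ _) `<< m ->
    mpush nu' (@measurable_fst _ _ _ _) `<< m.
  move=> nu'nu /null_content_dominatesP dom; apply/null_content_dominatesP.
  move=> B mB B0; have mTB : measurable (T @^-1` B : set (Borel X)).
    by rewrite -[X in measurable X]setTI; exact: measurable_shift.
  apply/eqP; rewrite eq_le measure_ge0 andbT.
  have mfB : measurable (fst @^-1` B : set XK).
    by rewrite -[X in measurable X]setTI; exact: measurable_fst.
  apply: le_trans (nu'nu _ mfB) _.
  rewrite le_eqVlt; apply/orP; left; apply/eqP; apply: (dom (T @^-1` B)) => //.
  exact: etrans (shift_invariant hp hq hm mB) B0.
move=> [ABp ABn]; split; [apply: aux ABp|apply: aux ABn] => E mE.
  exact: (jpos_le Fstar_difference mE).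
exact: (jneg_le Fstar_difference mE).
Qed.

Lemma disintegration_skew (nu nu' : {finite_measure set XK -> \bar R}) kappa :
  mpush nu (@measurable_fst _ _ _ _) `<< m -> disintegration m nu kappa ->
  (forall E, measurable E -> (nu' E <= mpush nu mS E)%E) ->
  exists kappa', disintegration m nu' kappa'.
Proof.
move=> nu1m dnu nu'nu.
have dom := @disintegration_dominated _ _ _ _ _ _ _ _ dnu nu1m.
apply: (@disintegration_exists _ _ _ _ _ m nu' _
  (measurable_skew_law (measurable_fiber_law dnu))).
move: dom => /null_content_dominatesP dom; apply/null_content_dominatesP.
move=> E mE; rewrite [X in X = _ -> _]semidirect_skew// => E0.
apply/eqP; rewrite eq_le measure_ge0 andbT.
apply: le_trans (nu'nu _ mE) _.
rewrite [leLHS]dom//.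
by rewrite -[X in measurable X]setTI; exact: mS.
Qed.

End skew_disintegration.

(** * The skew product does not increase the norm *)

Section contraction.
Context {R : realType} {N : nat} {A : aperiodic_matrix N}.
Context {theta : {itv R & `]0%Z, 1%Z[}} {K : pmetricType R}.
Local Notation X := (subshift A theta).
Local Notation XK := (Borel X * Borel K)%type.
Local Notation I := 'I_N.+1.
Local Notation T := (shift : Borel X -> Borel X).
Variables (m : probability (Borel X) R) (p : 'M[R]_N.+1) (q : 'rV[R]_N.+1).
Hypotheses (hp : stochastic_for (A := A) p) (hq : stationary p q).
Hypothesis hm : forall (n : nat) (a : nat -> I),
  m [set x : X | forall i, (i <= n)%N -> letter x i = a i] =
  (q 0 (a 0%N) * \prod_(i < n) p (a i) (a i.+1))%:E.
Variables (G : XK -> Borel K) (mG : measurable_fun setT G).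
Local Notation S := (Defs.skew G : XK -> XK).
Local Notation mS := (measurable_skew mG).
Local Notation F_ := (Fstar mG).
Hypothesis nonexpG : {ae m, forall x, forall y1 y2 : K,
  @mdist R K (G (x, y1)) (G (x, y2)) <= mdist y1 y2}.
Hypothesis cK : compact [set: K].

Lemma wnorm_ge0 (nu : {charge set (Borel K) -> \bar R}) : (0 <= wnorm nu)%E.
Proof.
apply: le_trans (abse_ge0 (charge_integral nu (cst 0))) _.
apply: ereal_sup_ubound; exists (cst 0) => //.
by apply: (@unit_test_cst _ _ 0); rewrite normr0.
Qed.

(** A finite norm is not the default value, so it is attained by some pair of
    disintegrations. *)
Lemma Linfty_bound (mu : {charge set XK -> \bar R}) : Linfty m mu ->
  exists kp kn c, [/\ disintegration m (jpos mu) kp,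
    disintegration m (jneg mu) kn, 0 <= c, norm_infty m mu = c%:E &
    {ae m, forall x, (wnorm (fiber_charge m mu kp kn x) <= c%:E)%E}].
Proof.
move=> [ABmu]; rewrite /norm_infty.
case: xgetP => [e _ [kp [kn [dp dn ee]]]|]//.
move=> elty.
have e0 : (0 <= e)%E.
  rewrite ee; apply: ess_sup_gee.
    have mT : m setT = 1%E := probability_setT m.
    by apply: (lt_le_trans lte01); rewrite -mT.
  by apply: aeW => x; exact: wnorm_ge0.
have efin : e \is a fin_num by rewrite ge0_fin_numE.
exists kp, kn, (fine e); split => //; [exact: fine_ge0|by rewrite fineK|].
by rewrite fineK// ee; exact: ess_sup_ge.
Qed.

(** Disintegrations are assumed to exist so that the norm is not the default
    value.  The bound holds for whichever pair the norm is computed with, as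
    the hypothesis does not mention disintegrations. *)
Lemma norm_infty_le (mu : {charge set XK -> \bar R}) kp kn (c : R) :
  AB m mu -> disintegration m (jpos mu) kp -> disintegration m (jneg mu) kn ->
  (forall (g : K -> R) E, unit_test g -> measurable E ->
    (`|charge_integral mu (fun z => g z.2 * \1_E z.1)%R| <= c%:E * m E)%E) ->
  (norm_infty m mu <= c%:E)%E.
Proof.
move=> ABmu dp dn dual; rewrite /norm_infty.
case: xgetP => [e _ [kp' [kn' [dp' dn' ->]]]|/(_ _)].
  by apply/ess_supP; exact: dual_bound_fiber.
move=> /(_ (ess_sup m (fun x => wnorm (fiber_charge m mu kp kn x)))) [].
by exists kp, kn.
Qed.

Lemma charge_integral_Fstar (mu : {charge set XK -> \bar R}) (F : XK -> R) M :
  measurable_fun setT F -> (forall z, `|F z| <= M) ->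
  charge_integral (F_ mu) F = charge_integral mu (F \o S).
Proof.
move=> mF FM.
rewrite (@charge_integralE _ _ _ _
  (mpush (jpos mu) mS) (mpush (jneg mu) mS) _ M)//.
  have mF' : measurable_fun setT (EFin \o F) by exact/measurable_EFinP.
  have push (nu : {finite_measure set XK -> \bar R}) :
      (\int[mpush nu mS]_z (F z)%:E = \int[nu]_z ((F \o S) z)%:E)%E.
    rewrite -[LHS]/(\int[pushforward nu S]_z (EFin \o F) z)%E.
    rewrite (integral_pushforward mS)// preimage_setT.
    apply: (bounded_integrable nu measurableT (M := M)) => // .
    exact: (measurableT_comp mF mS).
  by rewrite !push.
exact: Fstar_difference.
Qed.

(** Both norms are read as dual bounds; the test [g] and the set [E] for
    [F_* mu] become [g \o G] and the preimage of [E] for [mu]. *)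
Lemma Fstar_norm_infty (mu : {charge set XK -> \bar R}) : Linfty m mu ->
  Linfty m (F_ mu) /\ (norm_infty m (F_ mu) <= norm_infty m mu)%E.
Proof.
move=> Lmu; have [ABmu _] := Lmu.
have [kp [kn [c [dp dn c0 -> wc]]]] := Linfty_bound Lmu.
have ABF := AB_Fstar hp hq hm mG ABmu.
have FE := Fstar_difference mG mu.
have [kp' dp'] :=
  disintegration_skew hp hq hm (mG := mG) ABmu.1 dp (jpos_le FE).
have [kn' dn'] :=
  disintegration_skew hp hq hm (mG := mG) ABmu.2 dn (jneg_le FE).
have le_c : (norm_infty m (F_ mu) <= c%:E)%E.
  apply: (norm_infty_le ABF dp' dn') => g E ug mE.
  have mg : measurable_fun setT (g : Borel K -> R).
    by case: ug => /lipschitz_Borel_measurable.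
  have mF : measurable_fun setT (fun z : XK => g z.2 * \1_E z.1).
    apply: measurable_funM; first exact: (measurableT_comp mg measurable_snd).
    exact: (measurableT_comp (measurable_indic mE) measurable_fst).
  have FM (z : XK) : `|g z.2 * \1_E z.1| <= 1.
    rewrite normrM indicE.
    case: (_ \in _); rewrite ?normr1 ?normr0 ?mulr1 ?mulr0//.
    exact: ug.2.
  rewrite (charge_integral_Fstar mu mF FM).
  have mTE : measurable (T @^-1` E : set (Borel X)).
    by rewrite -[X in measurable X]setTI; exact: measurable_shift.
  have := shift_invariant hp hq hm mE => <-.
  apply: (fiber_bound_dual ABmu dp dn (F := g \o G) c0 wc _ _ _ mTE).
  - exact: (measurableT_comp mg mG).
  - by move=> z; exact: ug.2.
  - apply: filterS nonexpG => x xG y1 y2 /=.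
    by apply: le_trans (ug.1 _ _) _; rewrite !mul1r.
exact: (conj (conj ABF (le_lt_trans le_c (ltry c))) le_c).
Qed.

End contraction.

(** * Lipschitz densities on the base *)

Section lipschitz_constants.
Context {R : realType} {M : metricType R}.

Lemma lip_const_attained (f : M -> R) : (lip_const f < +oo)%E ->
  exists L, [/\ 0 <= L, lip_const f = L%:E & lipschitz_with L f].
Proof.
move=> flty.
have f0 : (0 <= lip_const f)%E.
  by apply: le_ereal_inf_tmp => _ [c [c0 _] <-]; rewrite lee_fin.
have ffin : lip_const f \is a fin_num by rewrite ge0_fin_numE.
exists (fine (lip_const f)); split; [exact: fine_ge0|by rewrite fineK|].
move=> x y; have [->|xy] := eqVneq x y.
  by rewrite subrr normr0 mulr_ge0 ?fine_ge0// mdist_ge0.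
have d0 : 0 < mdist x y by rewrite mdist_gt0.
rewrite -ler_pdivrMr// -lee_fin fineK//.
apply: le_ereal_inf_tmp => _ [c [c0 lc] <-].
by rewrite lee_fin ler_pdivrMr.
Qed.

Lemma lip_const_le (f : M -> R) c : 0 <= c -> lipschitz_with c f ->
  (lip_const f <= c%:E)%E.
Proof. by move=> c0 lc; apply: ereal_inf_lbound; exists c. Qed.

End lipschitz_constants.

Section densities.
Context {R : realType} {N : nat} {A : aperiodic_matrix N}.
Context {theta : {itv R & `]0%Z, 1%Z[}} {K : pmetricType R}.
Local Notation X := (subshift A theta).
Local Notation XK := (Borel X * Borel K)%type.
Local Notation I := 'I_N.+1.
Local Notation T := (shift : Borel X -> Borel X).
Local Notation t := (theta%:num).
Local Notation mfst := (@measurable_fst _ _ (Borel X) (Borel K)).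
Variables (m : probability (Borel X) R) (p : 'M[R]_N.+1) (q : 'rV[R]_N.+1).
Hypotheses (hp : stochastic_for (A := A) p) (hq : stationary p q).
Hypothesis hm : forall (n : nat) (a : nat -> I),
  m [set x : X | forall i, (i <= n)%N -> letter x i = a i] =
  (q 0 (a 0%N) * \prod_(i < n) p (a i) (a i.+1))%:E.

(** If [f x > b], then [f > b] on a cylinder around [x], which has positive
    mass. *)
Lemma lipschitz_ae_le (c b : R) (f : X -> R) : lipschitz_with c f ->
  {ae m, forall x, f x <= b} -> forall x, f x <= b.
Proof.
move=> lf [D [mD D0 fD]] x; rewrite leNgt; apply/negP => bfx.
have c1 : 0 < `|c| + 1 by rewrite ltr_wpDl.
have e0 : 0 < (f x - b) / (`|c| + 1) by rewrite divr_gt0// subr_gt0.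
have [n xn] := cylinder_small x e0.
have : (0 < m (cylinder (mkseq (letter x) n)))%E.
  exact: (cylinder_gt0 hp hq hm).
apply/negP; rewrite -leNgt -D0; apply: le_measure.
- by apply/mem_set; exact: measurable_cylinder.
- exact/mem_set.
move=> y /xn; rewrite ballEmdist/= ltr_pdivlMr// => xy; apply: fD => /= fyb.
have : f x - f y <= c * mdist x y by apply: le_trans (lf x y); exact: ler_norm.
have : c * mdist x y <= mdist x y * (`|c| + 1).
  rewrite mulrC ler_wpM2l ?mdist_ge0//.
  by rewrite (le_trans (ler_norm c))// lerDl.
by move: fyb xy; lra.
Qed.

Lemma lipschitz_bounded (c : R) (f : X -> R) : 0 <= c -> lipschitz_with c f ->
  forall x, `|f x| <= `|f point| + c * (1 - t)^-1.
Proof.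
move=> c0 lf x; rewrite -[X in `|X|](subrK (f point)) addrC.
apply: le_trans (ler_normD _ _) _; rewrite lerD2l//.
apply: le_trans (lf x point) _; rewrite ler_wpM2l//.
exact: dtheta_bounded.
Qed.

Section fixed_measure.
Variable mu : {charge set XK -> \bar R}.
Hypothesis ABmu : AB m mu.

Lemma marginal_dominated : cpush mu mfst `<< m.
Proof.
move: ABmu => [/null_content_dominatesP ABp /null_content_dominatesP ABn].
apply/null_content_dominatesP => B mB B0.
have mfB : measurable (fst @^-1` B : set XK).
  by rewrite -[X in measurable X]setTI; exact: mfst.
rewrite -[LHS]/(mu (fst @^-1` B)) jordan_difference//.
have -> : jpos mu (fst @^-1` B) = 0%E by exact: ABp.
have -> : jneg mu (fst @^-1` B) = 0%E by exact: ABn.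
by rewrite sube0.
Qed.

Lemma density_integral (phi : X -> R) B : lipschitz_density m mu phi ->
  measurable B ->
  (\int[m]_(x in B) (phi x)%:E = mu (fst @^-1` B))%E.
Proof.
move=> [phiE /lip_const_attained[L [L0 _ lphi]]] mB.
have mphi : measurable_fun setT (phi : Borel X -> R).
  exact: lipschitz_Borel_measurable lphi.
rewrite -[RHS]/(cpush mu mfst B).
rewrite [RHS](Radon_Nikodym_integral marginal_dominated mB).
apply: ae_eq_integral => //.
- exact/measurable_funTS/measurable_EFinP.
- apply: measurable_funTS.
  exact: measurable_int _ (Radon_Nikodym_integrable marginal_dominated).
- by apply: filterS phiE => x -> _.
Qed.

Lemma lipschitz_densityP (phi : X -> R) (L : R) :
  0 <= L -> lipschitz_with L phi ->
  (forall B, measurable B ->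
    (\int[m]_(x in B) (phi x)%:E = mu (fst @^-1` B))%E) ->
  lipschitz_density m mu phi.
Proof.
move=> L0 lphi phiE; split; last first.
  exact: le_lt_trans (lip_const_le L0 lphi) (ltry _).
have mphi : measurable_fun setT (phi : Borel X -> R).
  exact: lipschitz_Borel_measurable lphi.
have : ae_eq m setT ('d (cpush mu mfst) '/d m) (EFin \o phi).
  apply: integral_ae_eq => //.
  - exact: Radon_Nikodym_integrable marginal_dominated.
  - exact/measurable_EFinP.
  - move=> B _ mB; rewrite [RHS]phiE//.
    by rewrite -Radon_Nikodym_integral//; exact: marginal_dominated.
by apply: filterS => x; apply.
Qed.

(** Uniqueness makes the value of [density_norm] independent of choices. *)
Lemma lipschitz_density_unique (phi psi : X -> R) :
  lipschitz_density m mu phi -> lipschitz_density m mu psi -> phi = psi.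
Proof.
have aux (f g : X -> R) :
    lipschitz_density m mu f -> lipschitz_density m mu g ->
    forall x, f x - g x <= 0.
  move=> [fE /lip_const_attained[a [_ _ lf]]].
  move=> [gE /lip_const_attained[b [_ _ lg]]].
  apply: (@lipschitz_ae_le (a + b)).
    move=> x y.
    have -> : f x - g x - (f y - g y) = (f x - f y) - (g x - g y) by ring.
    by rewrite (le_trans (ler_normB _ _))// mulrDl lerD.
  by apply: filterS2 fE gE => x -> [->]; rewrite subrr.
move=> hphi hpsi; apply/funext => x; apply/eqP.
by rewrite eq_le -[_ <= psi x]subr_le0 -[psi x <= _]subr_le0 !aux.
Qed.

Lemma density_normE (phi : X -> R) : lipschitz_density m mu phi ->
  density_norm m mu = (sup_norm phi + lip_const phi)%E.
Proof.
move=> hphi; rewrite /density_norm; case: xgetP => [e _ [psi hpsi <-]|/(_ _)].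
  by rewrite (lipschitz_density_unique hphi hpsi).
by move=> /(_ (sup_norm phi + lip_const phi)%E)[]; exists phi.
Qed.

End fixed_measure.

(** The constant 1 is a test, and its fibre integral is the density. *)
Lemma density_le_norm (mu : {charge set XK -> \bar R}) (phi : X -> R) (c : R) :
  Linfty m mu -> (norm_infty m mu <= c%:E)%E -> lipschitz_density m mu phi ->
  forall x, `|phi x| <= c.
Proof.
move=> Lmu muc hphi; have [ABmu _] := Lmu.
have [kp [kn [b [dp dn b0 be wb]]]] := Linfty_bound Lmu.
have bc : b <= c by rewrite -lee_fin -be.
have [_ /lip_const_attained[L [L0 _ lphi]]] := hphi.
have mphi : measurable_fun setT (phi : Borel X -> R).
  exact: lipschitz_Borel_measurable lphi.
apply: (@lipschitz_ae_le L).
  by move=> x y; apply: le_trans (lphi x y); exact: ler_dist_dist.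
have : {ae m, forall x, (`|(phi x)%:E| <= b%:E)%E}.
  apply: ae_abs_le_of_integral_le.
    exact: (bounded_integrable m measurableT mphi (lipschitz_bounded L0 lphi)).
  move=> B mB; rewrite (density_integral ABmu hphi mB).
  have fb : (`|charge_integral mu (fun z : XK => cst 1 z * \1_B z.1)%R| <=
      b%:E * m B)%E.
    apply: (fiber_bound_dual ABmu dp dn (F := cst 1) b0 wb _ _ _ mB) => //.
    - by move=> z; rewrite normr1.
    - by apply: aeW => x y1 y2 /=; rewrite subrr normr0 mul1r mdist_ge0.
  apply: le_trans fb; rewrite le_eqVlt; apply/orP; left; apply/eqP.
  congr (`|_|%E).
  have mfB : measurable (fst @^-1` B : set XK).
    by rewrite -[X in measurable X]setTI; exact: mfst.
  rewrite /charge_integral jordan_difference//.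
  have indE (nu : {finite_measure set XK -> \bar R}) :
      (\int[nu]_z (cst 1 z * \1_B z.1)%:E = nu (fst @^-1` B))%E.
    rewrite -[in RHS](setIT (_ @^-1` _)) -[RHS]integral_indic//.
    by apply: eq_integral => z _ /=; rewrite mul1r.
  by rewrite !indE.
apply: (@filterS _ (almost_everywhere m)) => x.
by rewrite lee_fin => /le_trans; apply.
Qed.

End densities.

(** * The Lasota-Yorke inequality *)

Section lasota_yorke.
Context {R : realType} {N : nat} {A : aperiodic_matrix N}.
Context {theta : {itv R & `]0%Z, 1%Z[}} {K : pmetricType R}.
Local Notation X := (subshift A theta).
Local Notation XK := (Borel X * Borel K)%type.
Local Notation I := 'I_N.+1.
Local Notation T := (shift : Borel X -> Borel X).
Local Notation t := (theta%:num).
Local Notation mfst := (@measurable_fst _ _ (Borel X) (Borel K)).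
Variables (m : probability (Borel X) R) (p : 'M[R]_N.+1) (q : 'rV[R]_N.+1).
Hypotheses (hp : stochastic_for (A := A) p) (hq : stationary p q).
Hypothesis hm : forall (n : nat) (a : nat -> I),
  m [set x : X | forall i, (i <= n)%N -> letter x i = a i] =
  (q 0 (a 0%N) * \prod_(i < n) p (a i) (a i.+1))%:E.
Variables (G : XK -> Borel K) (mG : measurable_fun setT G).
Local Notation F_ := (Fstar mG).
Hypothesis nonexpG : {ae m, forall x, forall y1 y2 : K,
  @mdist R K (G (x, y1)) (G (x, y2)) <= mdist y1 y2}.
Hypothesis cK : compact [set: K].

Lemma transfer_density (mu : {charge set XK -> \bar R})
    (phi : X -> R) (L c : R) :
  AB m mu -> lipschitz_density m mu phi -> 0 <= L -> 0 <= c ->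
  lipschitz_with L phi -> (forall x, `|phi x| <= c) ->
  lipschitz_density m (F_ mu) (transfer p q phi).
Proof.
move=> ABmu hphi L0 c0 lphi phic.
have lip := transfer_lipschitz hp hq L0 c0 lphi phic.
apply: (lipschitz_densityP (AB_Fstar hp hq hm mG ABmu) _ lip) => [|B mB].
  by rewrite addr_ge0 ?mulr_ge0.
have mphi : measurable_fun setT (phi : Borel X -> R).
  exact: lipschitz_Borel_measurable lphi.
rewrite -(integral_transfer hp hq hm mphi phic mB).
rewrite (density_integral ABmu hphi)//.
by rewrite -[X in measurable X]setTI; exact: measurable_shift.
Qed.

(** [2 / (1 - theta) * c] is the fixed point of the affine recursion
    [a |-> theta * a + 2 * c] satisfied by the Lipschitz constants. *)
Lemma iter_bounds (mu : {charge set XK -> \bar R}) (phi : X -> R) (L c : R) n :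
  Linfty m mu -> norm_infty m mu = c%:E -> 0 <= c ->
  lipschitz_density m mu phi -> 0 <= L -> lipschitz_with L phi ->
  let mun := iter n F_ mu in
  [/\ Linfty m mun, (norm_infty m mun <= c%:E)%E &
    exists psi, lipschitz_density m mun psi /\
      lipschitz_with (t ^+ n * L + 2 / (1 - t) * c) psi].
Proof.
move=> Lmu muc c0 hphi L0 lphi /=.
have t1 : 0 < 1 - t by rewrite subr_gt0.
have C0 : 0 <= 2 / (1 - t) * c by rewrite mulr_ge0// divr_ge0// ltW.
elim: n => [|n [Ln nc [psi [hpsi lpsi]]]] /=.
  split => //; first by rewrite muc.
  exists phi; split => // x y; apply: le_trans (lphi x y) _.
  by rewrite ler_wpM2r ?mdist_ge0// expr0 mul1r lerDl.
have [LFn Fnc] := Fstar_norm_infty hp hq hm mG nonexpG cK Ln.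
split; [exact: LFn|exact: le_trans Fnc nc|].
have psic := density_le_norm hp hq hm Ln nc hpsi.
have Ln0 : 0 <= t ^+ n * L + 2 / (1 - t) * c.
  by rewrite addr_ge0// mulr_ge0// exprn_ge0.
exists (transfer p q psi); split.
  exact: (transfer_density Ln.1 hpsi Ln0 c0 lpsi psic).
have -> : t ^+ n.+1 * L + 2 / (1 - t) * c =
    t * (t ^+ n * L + 2 / (1 - t) * c) + 2 * c.
  by rewrite exprS; field; rewrite gt_eqF.
exact: (transfer_lipschitz hp hq Ln0 c0 lpsi psic).
Qed.

Lemma lasota_yorke (mu : {charge set XK -> \bar R}) n : Sinfty m mu ->
  (norm_Sinfty m (iter n F_ mu) <=
    (2 * t ^+ n)%:E * norm_Sinfty m mu +
    (2 + 2 / (1 - t))%:E * norm_infty m mu)%E.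
Proof.
move=> [Lmu [phi hphi]].
have [_ [_ [c [_ _ c0 muc _]]]] := Linfty_bound Lmu.
have [_ /lip_const_attained[L [L0 LE lphi]]] := hphi.
have [Ln nc [psi [hpsi lpsi]]] := iter_bounds n Lmu muc c0 hphi L0 lphi.
have t1 : 0 < 1 - t by rewrite subr_gt0.
have tn0 : 0 <= t ^+ n by rewrite exprn_ge0.
have Ln0 : 0 <= t ^+ n * L + 2 / (1 - t) * c.
  by rewrite addr_ge0// !mulr_ge0// invr_ge0 ltW.
have psic := density_le_norm hp hq hm Ln nc hpsi.
have phi0 : (0 <= sup_norm phi)%E.
  apply: (@le_trans _ _ (`|phi point|)%:E); first by rewrite lee_fin.
  by apply: ereal_sup_ubound; exists point.
have phic : (sup_norm phi <= c%:E)%E.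
  apply: ge_ereal_sup => _ [x _ <-]; rewrite lee_fin.
  by apply: (density_le_norm hp hq hm Lmu _ hphi); rewrite muc.
have sfin : sup_norm phi \is a fin_num.
  by rewrite ge0_fin_numE// (le_lt_trans phic)// ltry.
rewrite /norm_Sinfty.
rewrite (density_normE hp hq hm hpsi) (density_normE hp hq hm hphi).
rewrite muc LE -(fineK sfin) -!EFinD.
apply: (@le_trans _ _ (c + (t ^+ n * L + 2 / (1 - t) * c) + c)%:E).
  rewrite 2!EFinD; apply: leeD => //; apply: leeD.
    by apply: ge_ereal_sup => _ [x _ <-]; rewrite lee_fin.
  exact: lip_const_le.
rewrite lee_fin; have := fine_ge0 phi0; move: (fine _) => s s0.
have h1 : 0 <= t ^+ n * s by rewrite mulr_ge0.
have h2 : 0 <= t ^+ n * L by rewrite mulr_ge0.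
have h3 : 0 <= t ^+ n * c by rewrite mulr_ge0.
by move: (t ^+ n) (_ / _) h1 h2 h3 => u v h1 h2 h3; nra.
Qed.

End lasota_yorke.

Theorem proposition5p7 (R : realType) (N : nat) (A : aperiodic_matrix N)
    (theta : {itv R & `]0%Z, 1%Z[}) (K : pmetricType R)
    (compactK : compact [set: K]) (diamK : diam K = 1%E)
    (m : probability (Borel (subshift A theta)) R)
    (markov_m : markov_measure m)
    (G : (Borel (subshift A theta) * Borel K)%type -> Borel K)
    (mG : measurable_fun setT G)
    (alpha : R) (alpha_gt0 : 0 < alpha) (alpha_lt1 : alpha < 1)
    (contractG : {ae m, forall x, forall y1 y2 : K,
      @mdist R K (G (x, y1)) (G (x, y2)) <= alpha * mdist y1 y2}) :
  exists (alpha1 B4 : R), [/\ 0 < alpha1, alpha1 < 1 &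
    forall (mu : {charge set (Borel (subshift A theta) * Borel K)%type -> \bar R})
        (n : nat), Sinfty m mu -> (1 <= n)%N ->
      (norm_Sinfty m (iter n (Fstar mG) mu) <=
        (2 * alpha1 ^+ n)%:E * norm_Sinfty m mu + B4%:E * norm_infty m mu)%E].
Proof.
have [p [q [hp hq hm]]] := markov_m.
exists (theta%:num), (2 + 2 / (1 - theta%:num)); split => // mu n Smu _.
apply: (lasota_yorke hp hq hm) => //.
apply: filterS contractG => x Gx y1 y2; apply: le_trans (Gx y1 y2) _.
by rewrite ler_piMl ?mdist_ge0// ltW.
Qed.
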